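(* Let $W_n$ be the Coxeter group of type $B_n$ with $S=\{s_0,s_1,\dots,s_{n-1}\}$. Fix $J\subset S$ of size $m$, let $k=n-m$, and let $W_k$ be the Weyl group of type $B_k$, acting on $Y_k=\{-k,\dots,-1,0,1,\dots,k\}$. (1) If $p=p'.p''$ is a reduced composition of core cosets in $W_n$ (for $\mathbb{S}q$ landing in $W_k$, i.e. for cosets whose indexing subsets have size $m$), then $\mathbb{S}q(p)=\mathbb{S}q(p').\mathbb{S}q(p'')$ is a reduced composition in $W_k$ (i.e. the lengths add). (2) The map $\mathbb{S}q$ induces a bijection $$\mathbb{S}q^J\colon\{(I,p)\mid I\subset S,\ p\text{ is a core }(I,J)\text{-coset}\}\to W_k,$$ which restricts to a bijection between atomic $(I,J)$-cosets (as $I$ varies) and simple reflections of $W_k$. (3) Consequently, for any core $(I,J)$-coset $p$, the map $(p_1,\dots,p_d)\mapsto(\mathbb{S}q(p_1),\dots,\mathbb{S}q(p_d))$ sends atomic reduced expressions for $p$ bijectively to ordinary reduced expressions for $\mathbb{S}q(p)$.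
   Context: $W_n$ has simple reflections $s_0,\dots,s_{n-1}$ with $m_{s_0s_1}=4$, $m_{s_is_{i+1}}=3$ for $i\ge1$, and other pairs commuting. It is viewed as the group of permutations $\sigma$ of $X=\{-n,\dots,-1,0,1,\dots,n\}$ with $\sigma(-i)=-\sigma(i)$, where $s_0=(-1\ 1)$ and $s_i=(i\ i{+}1)(-i\ {-i}{-}1)$ for $i>0$. Similarly $W_k$ acts on $Y_k$. Write $W=W_n$ with length $\ell$. For $I\subset S$, $W_I$ is the parabolic subgroup, $w_I$ its longest element, $\ell(I)=\ell(w_I)$. An $(I,J)$-coset is an element $p\in W_I\backslash W/W_J$ (with $(I,J)$ part of the data), with Bruhat-maximal element $\overline p$ and Bruhat-minimal element $\underline p$. It is a core coset if $I=\underline pJ\underline p^{-1}$ (so $\#I=\#J$). Composition: let $*$ be the $0$-Hecke (star) product on $W$ ($s*w=sw$ if $\ell(sw)>\ell(w)$, else $s*w=w$). For an $(I,J)$-coset $p$ and a $(J,K)$-coset $q$, $p*q=W_I(\overline p*\overline q)W_K$, and $\overline{p*q}=\overline p*\overline q$. It is reduced, written $p.q$, if $\overline p*\overline q=(\overline pw_J^{-1})\overline q$ with $\ell(\overline p*\overline q)=\ell(\overline p)-\ell(J)+\ell(\overline q)$. A longer composition is reduced if each successive binary composition is. In a Coxeter group, $xy=x.y$ means $\ell(xy)=\ell(x)+\ell(y)$. Atomic coset: for $M\subset S$, $s\in M$, $t=w_Msw_M$, the $(M\setminus\{s\},M\setminus\{t\})$-coset containing $w_M$. An atomic reduced expression for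 a core coset $p$ is a sequence $(p_1,\dots,p_d)$ of composable atomic cosets whose composition is reduced and equals $p$ (the empty sequence is allowed for the identity coset). Squashing: for $J\subset S$, let $\sim_J$ be the equivalence relation on $X$ generated by $j\sim_J j+1$ and $-j\sim_J -j-1$ whenever $s_j\in J$. With $m=\#J$ and $k=n-m$, the classes are contiguous and are labeled in order $C_{-k}^{(J)}<\dots<C_{-1}^{(J)}<C_0^{(J)}<C_1^{(J)}<\dots<C_k^{(J)}$ with $0\in C_0^{(J)}$ and $C_{-c}^{(J)}=-C_c^{(J)}$; so $X/{\sim_J}$ is identified with $Y_k$. For $I,J$ of size $m$, an element $y\in W$ is a block permutation relative to $I$ and $J$ if it sends each class $C_c^{(J)}$ by an order-preserving bijection onto some class $C_{c'}^{(I)}$; then $\mathbb{S}q(y)$ is the induced permutation $c\mapsto c'$ of $Y_k$, which lies in $W_k$. For a core $(I,J)$-coset $p$, $\underline p$ is a block permutation relative to $I$ and $J$, and $\mathbb{S}q(p):=\mathbb{S}q(\underline p)$. *)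

(* Defs.v *)
From HB Require Import structures.
From mathcomp Require Import all_boot all_fingroup all_algebra.
From mathcomp Require Import zify.

Set Implicit Arguments.
Unset Strict Implicit.
Unset Printing Implicit Defensive.

Local Open Scope group_scope.

(* X n is the type of {-n, ..., n}: the point i : X n stands for the integer
   i - n, so that the order is the usual one and negation is rev_ord. *)
Local Notation X n := 'I_(n.*2.+1).

(* The point with integer value z, for -n <= z <= n. *)
Definition pt (n : nat) (z : int) : X n := inord (absz (n%:Z + z)%R).

Definition is_signed n (s : {perm X n}) : bool :=
  [forall i : X n, s (rev_ord i) == rev_ord (s i)].

Record W (n : nat) := SignedPerm { wperm :> {perm X n}; _ : is_signed wperm }.

HB.instance Definition _ n := [isSub for @wperm n].
HB.instance Definition _ n := [Finite of W n by <:].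

Section SignedPermGroup.
Variable n : nat.
Implicit Types x y z : W n.

Fact signed_one : is_signed (1 : {perm X n}).
Proof. by apply/forallP => i; rewrite !perm1. Qed.

Fact signed_mul x y : is_signed (wperm y * wperm x).
Proof.
have /forallP hx := valP x; have /forallP hy := valP y.
by apply/forallP => i; rewrite !permM (eqP (hy i)) (eqP (hx _)).
Qed.

Fact signed_inv x : is_signed (wperm x)^-1.
Proof.
have /forallP hx := valP x; apply/forallP => i.
by rewrite -(inj_eq (@perm_inj _ (wperm x))) permKV (eqP (hx _)) permKV.
Qed.

(* MathComp's product of permutations is (s * t) i = t (s i); W n carries the
   opposite product, that is, composition of functions (see wmulE). *)
Definition wone : W n := SignedPerm signed_one.
Definition wmul x y : W n := SignedPerm (signed_mul x y).
Definition winv x : W n := SignedPerm (signed_inv x).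

Fact wmulA : associative wmul.
Proof. by move=> x y z; apply/val_inj => /=; rewrite mulgA. Qed.
Fact wmul1 : left_id wone wmul.
Proof. by move=> x; apply/val_inj => /=; rewrite mulg1. Qed.
Fact wmulV : left_inverse wone winv wmul.
Proof. by move=> x; apply/val_inj => /=; rewrite mulgV. Qed.

HB.instance Definition _ := Finite_isGroup.Build (W n) wmulA wmul1 wmulV.

Lemma wmulE x y i : (x * y) i = x (y i).
Proof. by rewrite /= permM. Qed.

End SignedPermGroup.

Fact rev_pt n (z : int) : (absz z <= n)%N -> rev_ord (pt n z) = pt n (- z)%R.
Proof. by move=> hz; apply/val_inj; rewrite /= /pt !inordK; lia. Qed.

Definition sref_perm n (i : 'I_n) : {perm X n} :=
  let j : int := (i%:Z)%R in
  if i == 0 :> nat then tperm (pt n (-1)%R) (pt n 1%R)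
  else tperm (pt n j) (pt n (j + 1)%R) * tperm (pt n (- j)%R) (pt n (- j - 1)%R).

Fact signed_sref n (i : 'I_n) : is_signed (sref_perm i).
Proof.
have ltin := ltn_ord i; apply/forallP => x; apply/eqP.
rewrite /sref_perm; case: eqP => [i0 | /eqP i0].
  rewrite (inj_tperm _ _ _ (@rev_ord_inj _)) !rev_pt; try lia.
  by rewrite GRing.opprK tpermC.
rewrite !permM !(inj_tperm _ _ _ (@rev_ord_inj _)) !rev_pt; try lia.
rewrite !GRing.opprD !GRing.opprK -!permM; congr (fun_of_perm _ _).
set a := tperm _ _; set b := tperm _ _.
suff ab : a ^ b = a by rewrite [a * b]conjgC ab.
rewrite tpermJ /b !tpermD //; apply/eqP => /(congr1 val);
  by rewrite /= /pt !inordK; lia.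
Qed.

Definition sref n (i : 'I_n) : W n := SignedPerm (signed_sref i).

Section Coxeter.
Variable n : nat.
Implicit Types (w x y z t : W n) (I J K M : {set 'I_n}).

Definition srefs : {set W n} := [set sref i | i : 'I_n].

Definition wprod (u : seq 'I_n) : W n := \prod_(i <- u) sref i.

(* The least d such that w is a product of d simple reflections. The simple
   reflections generate W n, and the partial products of a word of minimal
   length are distinct, so this d is less than #|{: W n}|. *)
Definition len w : nat :=
  find (fun d => [exists u : d.-tuple 'I_n, wprod u == w]) (iota 0 #|{: W n}|).

Definition is_reflection t : bool :=
  [exists w, exists i, t == w * sref i * w^-1].

Definition bruhat : rel (W n) :=
  connect [rel x y | (len x < len y) && [exists t, is_reflection t && (y == t * x)]].

Definition parabolic I : {group W n} := <<[set sref i | i in I]>>%G.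

Definition longest I : W n := [arg max_(w > 1 in parabolic I) len w].

(* A double coset together with its indexing subsets: the triple (I, J, p). *)
Definition is_dcoset (c : {set 'I_n} * {set 'I_n} * {set W n}) : bool :=
  [exists x, c.2 == parabolic c.1.1 * [set x] * parabolic c.1.2].

Definition dcoset : Type := {c : {set 'I_n} * {set 'I_n} * {set W n} | is_dcoset c}.

Implicit Types p q : dcoset.

Definition lft p : {set 'I_n} := (val p).1.1.
Definition rgt p : {set 'I_n} := (val p).1.2.
Definition elts p : {set W n} := (val p).2.

Fact mk_dcoset_proof I J x :
  is_dcoset (I, J, parabolic I * [set x] * parabolic J).
Proof. by apply/existsP; exists x. Qed.

Definition mk_dcoset I J x : dcoset :=
  Sub (I, J, parabolic I * [set x] * parabolic J) (mk_dcoset_proof I J x).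

(* The greatest and least elements of p for the Bruhat order, which always
   exist: the default value 1 is never used. *)
Definition maxel p : W n :=
  odflt 1 [pick x in elts p | [forall y in elts p, bruhat y x]].
Definition minel p : W n :=
  odflt 1 [pick x in elts p | [forall y in elts p, bruhat x y]].

(* I = p_min J p_min^-1; recall that A :^ x is x^-1 A x. *)
Definition core p : bool :=
  [set sref i | i in lft p] == [set sref j | j in rgt p] :^ (minel p)^-1.

Definition star_sref (i : 'I_n) w : W n :=
  if len w < len (sref i * w) then sref i * w else w.

Definition reduced_word w : seq 'I_n :=
  if [pick u : (len w).-tuple 'I_n | wprod u == w] is Some u then u else [::].

(* The 0-Hecke product: s_1 * (s_2 * ... (s_d * y)), for x = s_1 ... s_d a
   reduced expression, whose choice does not matter. *)
Definition star x y : W n := foldr star_sref y (reduced_word x).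

(* The composition p * q; it is only meaningful when rgt p = lft q. *)
Definition dcomp p q : dcoset :=
  mk_dcoset (lft p) (rgt q) (star (maxel p) (maxel q)).

Definition reduced p q : bool :=
  let wJ := longest (rgt p) in
  [&& rgt p == lft q,
      star (maxel p) (maxel q) == maxel p * wJ^-1 * maxel q &
      len (star (maxel p) (maxel q)) + len wJ == len (maxel p) + len (maxel q)].

Definition atomic p : bool :=
  [exists M : {set 'I_n}, exists s in M, exists t : 'I_n,
    (sref t == longest M * sref s * longest M) &&
    (p == mk_dcoset (M :\ s) (M :\ t) (longest M))].

(* The composition p.q_1.q_2. ... is reduced. *)
Fixpoint reduced_seq p (qs : seq dcoset) : bool :=
  if qs is q :: qs' then reduced p q && reduced_seq (dcomp p q) qs' else true.

(* The empty sequence expresses the identity cosets. *)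
Definition atomic_rex p (ps : seq dcoset) : bool :=
  all atomic ps &&
  if ps is q :: qs then reduced_seq q qs && (p == foldl dcomp q qs)
  else p == mk_dcoset (lft p) (lft p) 1.

Definition rex w (u : seq (W n)) : bool :=
  [&& all (mem srefs) u, \prod_(t <- u) t == w & size u == len w].

(* The relation ~_J on X n. *)
Definition sq_step J : rel (X n) := fun x y : X n =>
  [exists j in J,
    ((x == pt n (j%:Z)%R) && (y == pt n (j%:Z + 1)%R)) ||
    ((x == pt n (- j%:Z)%R) && (y == pt n (- j%:Z - 1)%R))].

Definition sq_equiv J : rel (X n) :=
  connect (fun x y : X n => sq_step J x y || sq_step J y x).

Definition sq_classes J : {set {set X n}} :=
  equivalence_partition (sq_equiv J) [set: X n].

Definition class_lt (A B : {set X n}) : bool :=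
  [forall a in A, forall b in B, a < b].

(* C_c^(J), for c : X k with k = n - #|J|: the class with exactly (c : nat)
   classes before it, where (c : nat) is k plus the label of the class. *)
Definition sq_class k J (c : X k) : {set X n} :=
  \bigcup_(A in sq_classes J | #|[set B in sq_classes J | class_lt B A]| == c) A.

(* y is a block permutation relative to I and J which induces z. *)
Definition induces k I J y (z : W k) : bool :=
  [forall c : X k,
    (y @: sq_class J c == sq_class I (z c)) &&
    [forall a in sq_class J c, forall b in sq_class J c, (a < b) ==> (y a < y b)]].

(* At most one z is induced by y, as the classes are nonempty and pairwise
   distinct; the value is 1 when y is not a block permutation. *)
Definition Sqw k I J y : W k := odflt 1 [pick z : W k | induces I J y z].

Definition Sq k p : W k := Sqw k (lft p) (rgt p) (minel p).

Definition core_pairs J : pred ({set 'I_n} * dcoset) := fun c =>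
  [&& lft c.2 == c.1, rgt c.2 == J & core c.2].

Definition atomic_pairs J : pred ({set 'I_n} * dcoset) := fun c =>
  [&& lft c.2 == c.1, rgt c.2 == J & atomic c.2].

Definition SqJ k (c : {set 'I_n} * dcoset) : W k := Sq k c.2.

End Coxeter.

(* f restricts to a bijection from A onto B. *)
Definition bij_on (T U : Type) (A : pred T) (B : pred U) (f : T -> U) : Prop :=
  [/\ forall x, A x -> B (f x),
      forall x y, A x -> A y -> f x = f y -> x = y &
      forall z, B z -> exists2 x, A x & f x = z].

(* Main.v *)
Require Import Defs.
From mathcomp Require Import all_boot all_fingroup all_algebra zify.

(** Length, Bruhat extrema and the star product are all defined by searches or choices, so each
    needs a usable characterization. For the length this includes a bound: its search stops at the
    order of the group, and inversion counts must be shown to stay below it. All information on J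
    passes through the monotone function [clv], which counts the gaps below a point that separate
    classes. A gap and its mirror image belong to the same reflection, so J is handled through gaps,
    and block permutations through consecutive points ([blk]). A core (I,J)-coset with minimal
    element x is just x W_J, because W_I x = x W_J. Its maximal element is therefore x w_J, and in a
    star product w_J is absorbed by the next factor y w_K, which has all of J among its left
    descents; this is why only minimal elements matter for reducedness. Working from the right is
    forced by the data: only the right set J is given, and the left set of a coset is known once the
    coset is. *)

(* Everything is read off the one-line notation of a signed permutation. The
   length counts inversions, so lengths add in x y exactly when x undoes no
   inversion of y. If x is the minimal element of a core (I,J)-coset, it maps the
   classes of J onto those of I, as order-preserving shifts; two points in
   different classes are then inverted exactly when the squashed permutation
   inverts their classes. So lengths add for x y if and only if they add after
   squashing, and a composition of core cosets is reduced if and only if lengths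
   add for the minimal elements. The minimal element of an atomic coset is
   w_M w_J; its squash preserves all classes but the two pairs merged in M, and
   is not 1, so it is a simple reflection. A block permutation inducing 1 is
   increasing, hence trivial, which gives injectivity; surjectivity and the lifting
   of reduced words follow by composing atomic cosets from the right. *)

Set Implicit Arguments.
Unset Strict Implicit.
Unset Printing Implicit Defensive.

Local Open Scope group_scope.

Local Notation X n := 'I_(n.*2.+1).

Ltac split_hyps := repeat match goal with
  | H : or3 _ _ _ |- _ => destruct H
  | H : and3 _ _ _ |- _ => destruct H
  | H : _ \/ _ |- _ => destruct H
  | H : _ /\ _ |- _ => destruct H
  end.

Ltac lia_ifs := repeat (let h := fresh in case: ifPn => h); lia.

(** * Signed permutations and their inversions *)

Section SignedPermutations.
Variable n : nat.
Implicit Types (w x y z : W n) (a b c : X n) (i j : 'I_n).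

Lemma wperm_ext x y : (forall a, x a = y a) -> x = y.
Proof. by move=> h; apply/val_inj/permP. Qed.

Lemma wone_id a : (1 : W n) a = a.
Proof. exact: perm1. Qed.

Lemma wK x a : x^-1 (x a) = a.
Proof. by rewrite -wmulE mulVg wone_id. Qed.

Lemma wVK x a : x (x^-1 a) = a.
Proof. by rewrite -wmulE mulgV wone_id. Qed.

Lemma wrev x a : x (rev_ord a) = rev_ord (x a).
Proof. by have /forallP/(_ a)/eqP := valP x. Qed.

Lemma val_rev a : rev_ord a = n.*2 - a :> nat.
Proof. by rewrite /= subSS. Qed.

Lemma wperm_inj x : injective x.
Proof. exact: perm_inj. Qed.

Lemma wlt_neg x a b : (x (rev_ord b) < x (rev_ord a)) = (x a < x b).
Proof. by rewrite !wrev !val_rev; have := ltn_ord (x a); have := ltn_ord (x b); lia. Qed.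

Lemma wctr x a : a = n :> nat -> x a = n :> nat.
Proof.
move=> an; have ra : rev_ord a = a by apply: ord_inj; rewrite val_rev an; lia.
have := congr1 (@nat_of_ord _) (wrev x a); rewrite ra val_rev => h.
by have := ltn_ord (x a); rewrite /= in h *; lia.
Qed.

Lemma ord_eqE a b : (a == b) = (a == b :> nat).
Proof. by []. Qed.

Lemma tperm_val a b c :
  tperm a b c = (if c == a :> nat then nat_of_ord b else if c == b :> nat then nat_of_ord a else c) :> nat.
Proof.
by case: tpermP => [->|->|/eqP h1 /eqP h2]; rewrite ?eqxx //;
  [case: eqP => // -> | rewrite -!val_eqE /= in h1 h2; rewrite (negbTE h1) (negbTE h2)].
Qed.

(** Coordinates are shifted by n, so that v = n is the integer 0; this form reduces questions on
    [sref] to case splits for [lia]. *)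
Definition sref_val (i v : nat) : nat :=
  if i == 0 then (if v.+1 == n then n.+1 else if v == n.+1 then n.-1 else v)
  else if v == n + i then (n + i).+1 else if v == (n + i).+1 then n + i
  else if v + i == n then v.-1 else if (v + i).+1 == n then v.+1 else v.

Lemma srefE i a : sref i a = sref_val i a :> nat.
Proof.
have ltin := ltn_ord i; have lta := ltn_ord a.
rewrite /sref /= /sref_perm /sref_val; case: eqP => i0.
  by rewrite tperm_val /pt !inordK; try lia; lia_ifs.
rewrite permM; set v := tperm _ _ a.
have : v = tperm (pt n i%:Z%R) (pt n (i%:Z + 1)%R) a :> nat by [].
rewrite !tperm_val; move: (nat_of_ord v) => {}v.
by rewrite /pt !inordK; try lia; lia_ifs.
Qed.

Definition lo i : X n := inord (n + i).
Definition hi i : X n := inord (n + i).+1.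

Lemma lo_val i : lo i = n + i :> nat.
Proof. by rewrite /lo inordK //; have := ltn_ord i; lia. Qed.

Lemma hi_val i : hi i = (n + i).+1 :> nat.
Proof. by rewrite /hi inordK //; have := ltn_ord i; lia. Qed.

(** The points [lo i] and [hi i] are the integers i and i + 1. For i = 0 the test reads x(1) < x(0)
    = 0, the usual descent condition for s_0, so all i are treated alike. *)
Definition desc x i : bool := x (hi i) < x (lo i).

Lemma ndesc x i : ~~ desc x i = (x (lo i) < x (hi i)).
Proof.
rewrite -leqNgt leq_eqVlt; case: eqP => // /val_inj/wperm_inj/(congr1 val).
by rewrite /= lo_val hi_val; lia.
Qed.

Lemma sref_sref i : sref i * sref i = 1.
Proof.
apply/wperm_ext => a; apply: ord_inj; rewrite wmulE wone_id srefE.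
have := srefE i a; move: (nat_of_ord (sref i a)) => v; have := ltn_ord i.
by rewrite /sref_val; lia_ifs.
Qed.

Lemma srefV i : (sref i)^-1 = sref i.
Proof. by apply: (mulgI (sref i)); rewrite mulgV sref_sref. Qed.

Lemma srefK i : involutive (sref i).
Proof. by move=> a; rewrite -wmulE sref_sref wone_id. Qed.

Lemma sref_hi_lt i j : (sref j (hi i) < hi i) = (i == j).
Proof.
rewrite -val_eqE /= srefE hi_val; have := ltn_ord i; have := ltn_ord j.
by rewrite /sref_val; lia_ifs.
Qed.

Lemma sref_inj : injective (@sref n).
Proof.
by move=> i j e; apply/eqP; rewrite -sref_hi_lt -e sref_hi_lt.
Qed.

(* The pairs (a, b) and (-b, -a) stand for the same root, the pairs (-a, a) for a
   root of their own, and the pairs through 0 for none: the weight makes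
   each root count twice. *)
Definition wt a b : nat :=
  if (rev_ord a == a) || (rev_ord b == b) then 0 else (b == rev_ord a).+1.

Lemma wt_act x a b : wt (x a) (x b) = wt a b.
Proof. by rewrite /wt -!wrev !(inj_eq (@wperm_inj x)). Qed.

Lemma wt_sym a b : wt a b = wt b a.
Proof.
have e : (b == rev_ord a) = (a == rev_ord b).
  by rewrite eq_sym (can2_eq (@rev_ordK _) (@rev_ordK _)).
by rewrite /wt orbC e.
Qed.

Definition ninv x : nat := \sum_(a : X n) \sum_(b : X n) ((a < b) && (x b < x a)) * wt a b.

Definition undone x y : nat :=
  \sum_(a : X n) \sum_(b : X n) [&& a < b, y b < y a & x (y a) < x (y b)] * wt a b.

(** Pull the inversions of x back along y. Let A be the weight of the pairs that only x inverts and
    B that of the pairs inverted by y and left so by x. Then [ninv x] is A + [undone x y], [ninv y]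
    is B + [undone x y], and [ninv (x * y)] is A + B. *)
Lemma ninv_mul x y : ninv (x * y) + (undone x y).*2 = ninv x + ninv y.
Proof.
have inv_y : ninv x = \sum_(a : X n) \sum_(b : X n) ((y a < y b) && (x (y b) < x (y a))) * wt a b.
  rewrite {1}/ninv (reindex_inj (@wperm_inj y)); apply: eq_bigr => a _.
  by rewrite (reindex_inj (@wperm_inj y)); apply: eq_bigr => b _; rewrite wt_act.
have -> : ninv x = \sum_(a : X n) \sum_(b : X n)
    (((a < b) && ((y a < y b) && (x (y b) < x (y a)))) * wt a b
     + ((a < b) && ((y b < y a) && (x (y a) < x (y b)))) * wt a b).
  transitivity (\sum_(a : X n) \sum_(b : X n) ((a < b) && ((y a < y b) && (x (y b) < x (y a)))) * wt a b
     + \sum_(a : X n) \sum_(b : X n) ((a < b) && ((y b < y a) && (x (y a) < x (y b)))) * wt a b);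
    last by rewrite -big_split; apply: eq_bigr => a _; rewrite -big_split.
  rewrite [Z in _ + Z]exchange_big -big_split inv_y; apply: eq_bigr => a _.
  rewrite -big_split; apply: eq_bigr => b _; rewrite /= (wt_sym b a).
  case: (ltngtP a b) => [ab|ab|/val_inj ->] /=; rewrite ?ltnn /=; lia.
rewrite -(addnn (undone x y)) /ninv /undone -!big_split; apply: eq_bigr => a _ /=.
rewrite -!big_split; apply: eq_bigr => b _ /=; rewrite !wmulE.
case: (ltnP a b) => //= ab.
have : (y a : nat) != y b.
  by rewrite val_eqE (inj_eq (@wperm_inj y)) -val_eqE /=; lia.
have : (x (y a) : nat) != x (y b).
  by rewrite val_eqE !(inj_eq (@wperm_inj _)) -val_eqE /=; lia.
by case: ltngtP => //; case: ltngtP => //=; lia.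
Qed.

End SignedPermutations.

Section InvSref.
Variable n : nat.
Implicit Types (w x y z : W n) (a b c : X n) (i j : 'I_n).

Lemma sref_cases i a (v := nat_of_ord a) (u := nat_of_ord (sref i a)) :
  if (i : nat) is 0 then
    [\/ v.+1 = n /\ u = n.+1, v = n.+1 /\ u.+1 = n | [/\ v.+1 != n, v != n.+1 & u = v]]
  else (v = n + i /\ u = (n + i).+1) \/ (v = (n + i).+1 /\ u = n + i) \/ [\/
         v + i = n /\ u.+1 = v,
         (v + i).+1 = n /\ u = v.+1
       | u = v /\ [&& v != n + i, v != (n + i).+1, v + i != n & (v + i).+1 != n]].
Proof.
rewrite {}/u {}/v srefE /sref_val; have := ltn_ord i.
move: (nat_of_ord a) (nat_of_ord i) => {}a [|{}i] hi /=.
  by case: eqP => [?|h1]; [constructor 1 | case: eqP => [?|h2];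
    [constructor 2 | constructor 3]]; repeat split; lia.
case: eqP => [?|h1]; first by left; lia.
case: eqP => [?|h2]; [by right; left; lia | right; right].
case: eqP => h3; first by constructor 1; lia.
case: eqP => h4; first by constructor 2; lia.
by constructor 3; repeat split; lia.
Qed.

(** A simple reflection inverts only its own root. For i = 0 the two pairs on the right coincide,
    which matches the weight 2 of (-1, 1), while the inverted pairs (-1, 0) and (0, 1) pass through
    0 and weigh nothing. *)
Lemma inverted_sref i a b :
  (((a < b) && (sref i b < sref i a)) * wt a b
  = ((a, b) == (sref i (hi i), hi i))
    + ((a, b) == (rev_ord (hi i), rev_ord (sref i (hi i)))))%N.
Proof.
rewrite /wt !xpair_eqE !ord_eqE !val_rev hi_val.
have := sref_cases i a; have := sref_cases i b; have := sref_cases i (hi i).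
have := ltn_ord i; have := ltn_ord a; have := ltn_ord b; rewrite hi_val.
move: (nat_of_ord (sref i a)) (nat_of_ord (sref i b)) (nat_of_ord (sref i (hi i))) => sa sb sh.
move: (nat_of_ord a) (nat_of_ord b) (nat_of_ord i) => {}a {}b {}i hb ha hi.
cbv zeta; case: i hi => [|i] hi hsh.
  have {hsh} -> : sh = n.-1 by split_hyps; lia.
  rewrite addn0; case: ltnP => [ab|] /=; last by lia.
  case: ltnP => sab h2 h1 /=.
    have {h1 h2 sab sa sb} : [\/ a = n.-1 /\ b = n, a = n /\ b = n.+1 | a = n.-1 /\ b = n.+1].
      by split_hyps; first [constructor 1; lia | constructor 2; lia | constructor 3; lia | lia].
    by case=> [] [-> ->]; lia_ifs.
  have {h1 h2 sab sa sb} : ~ (a = n.-1 /\ b = n.+1) by move=> [] *; split_hyps; lia.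
  by lia.
have {hsh} -> : sh = (n + i.+1)%N by split_hyps; lia.
case: ltnP => [ab|] /=; last by lia.
case: ltnP => sab h2 h1 /=.
  have {h1 h2 sab sa sb} : b = a.+1 /\ (a = n + i.+1 \/ b + i.+1 = n) by split_hyps; lia.
  by case=> -> [] h; lia_ifs.
have {h1 h2 sab sa sb} : ~ (b = a.+1 /\ (a = n + i.+1 \/ b + i.+1 = n)).
  by move=> [] ? [] ?; split_hyps; lia.
by lia.
Qed.
End InvSref.

(** * Length *)

Section Length.
Variable n : nat.
Implicit Types (w x y z : W n) (a b c : X n) (i j : 'I_n).

Lemma sum_delta (p : X n * X n) (f : X n -> X n -> nat) :
  (\sum_(a : X n) \sum_(b : X n) ((a, b) == p) * f a b = f p.1 p.2)%N.
Proof.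
rewrite pair_bigA (bigD1 p) //= -surjective_pairing eqxx mul1n big1 ?addn0 // => q.
by rewrite -surjective_pairing => /negbTE ->.
Qed.

Lemma sref_hi i : (i : nat) != 0 -> sref i (hi i) = lo i.
Proof.
move=> i0; apply: ord_inj; rewrite srefE hi_val lo_val /sref_val.
by have := ltn_ord i; lia_ifs.
Qed.

Lemma sref_hi0 i : (i : nat) = 0 -> sref i (hi i) = rev_ord (hi i).
Proof.
move=> i0; apply: ord_inj; rewrite srefE val_rev hi_val /sref_val.
by have := ltn_ord i; lia_ifs.
Qed.

Lemma descE x i : desc x i = (x (hi i) < x (sref i (hi i))).
Proof.
rewrite /desc; case: (eqVneq (i : nat) 0) => i0; last by rewrite sref_hi.
rewrite sref_hi0 // wrev val_rev (@wctr _ x (lo i)) ?lo_val ?i0 ?addn0 //.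
by have := ltn_ord (x (hi i)); lia.
Qed.

Lemma sum_inverted_sref i (f : X n -> X n -> nat) :
  (\sum_(a : X n) \sum_(b : X n) ((a < b) && (sref i b < sref i a)) * wt a b * f a b
   = f (sref i (hi i)) (hi i) + f (rev_ord (hi i)) (rev_ord (sref i (hi i))))%N.
Proof.
under eq_bigr => a _ do
  (under eq_bigr => b _ do rewrite inverted_sref mulnDl; rewrite big_split).
by rewrite big_split /= !sum_delta.
Qed.

Lemma ninv_sref i : ninv (sref i) = 2.
Proof.
transitivity (\sum_(a : X n) \sum_(b : X n)
    ((a < b) && (sref i b < sref i a)) * wt a b * 1)%N.
  by apply: eq_bigr => a _; apply: eq_bigr => b _; rewrite muln1.
by rewrite (sum_inverted_sref i (fun _ _ => 1%N)).
Qed.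

Lemma undone_sref x i : undone x (sref i) = (desc x i).*2.
Proof.
transitivity (\sum_(a : X n) \sum_(b : X n)
    ((a < b) && (sref i b < sref i a)) * wt a b * (x (sref i a) < x (sref i b)))%N.
  apply: eq_bigr => a _; apply: eq_bigr => b _; rewrite -!mulnA [(wt a b * _)%N]mulnC mulnA.
  by rewrite mulnb andbA.
rewrite (sum_inverted_sref i (fun a b => x (sref i a) < x (sref i b))) descE.
by rewrite (wrev (sref i) (hi i)) (wrev (sref i) (sref i _)) wlt_neg srefK addnn.
Qed.

Lemma ninv_mul_sref x i : ninv (x * sref i) + (desc x i).*2.*2 = (ninv x).+2.
Proof. by rewrite -undone_sref ninv_mul ninv_sref addn2. Qed.

Lemma ninv1 : ninv (1 : W n) = 0.
Proof.
rewrite /ninv big1 // => a _; rewrite big1 // => b _; rewrite !wone_id.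
by case: (ltngtP a b).
Qed.

(** Starting from x(0) = 0, rising steps give a <= x a on nonnegative points. Equality follows by
    downward induction: if x a were larger than a, it would already be a fixed point, against
    injectivity. Negative points follow by symmetry. *)
Lemma no_desc x : (forall i, ~~ desc x i) -> x = 1.
Proof.
move=> h.
have up d (a : X n) : (n + d)%N = a :> nat -> a <= x a.
  elim: d a => [|d IHd] a; first by rewrite addn0 => an; rewrite (wctr x (esym an)) -an.
  move=> da; have lta := ltn_ord a; have ltd : d < n by lia.
  have ltp : a.-1 < n.*2.+1 by lia.
  have [e1 e2] : lo (Ordinal ltd) = Ordinal ltp /\ hi (Ordinal ltd) = a.
    by split; apply: ord_inj; rewrite ?lo_val ?hi_val /=; lia.
  have := h (Ordinal ltd); rewrite ndesc e2 e1.
  have := IHd (Ordinal ltp) => /=; lia.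
have upn (a : X n) : n <= a -> x a = a.
  move=> na; apply: ord_inj.
  have [m hm] := ubnP (n.*2 - a); elim: m a na hm => // m IHm a na hm.
  have := up (a - n)%N a; rewrite subnKC // => /(_ erefl).
  rewrite leq_eqVlt => /orP[/eqP //|lt].
  have e : x (x a) = x a :> nat by have := ltn_ord (x a); move=> ?; apply: IHm; lia.
  by have /wperm_inj /(congr1 (@nat_of_ord _)) := ord_inj e.
apply: wperm_ext => a; rewrite wone_id; case: (leqP n a) => na; first exact: upn.
apply: rev_ord_inj; rewrite -wrev upn // val_rev; lia.
Qed.

Lemma exists_desc x : x != 1 -> exists i, desc x i.
Proof.
move=> x1; apply/existsP; rewrite -[Z in is_true Z]negbK negb_exists; apply: contra x1.
by move=> /forallP h; apply/eqP/no_desc.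
Qed.

Lemma wprod_rcons (u : seq 'I_n) i : wprod (rcons u i) = wprod u * sref i.
Proof. by rewrite /wprod -cats1 big_cat big_seq1. Qed.

Lemma wprod_cons (u : seq 'I_n) i : wprod (i :: u) = sref i * wprod u.
Proof. by rewrite /wprod big_cons. Qed.

Lemma ninv_wprod (u : seq 'I_n) : ninv (wprod u) <= (size u).*2.
Proof.
elim/last_ind: u => [|u i IHu]; first by rewrite /wprod big_nil ninv1.
by rewrite wprod_rcons size_rcons; have := ninv_mul_sref (wprod u) i; lia.
Qed.

Lemma ninv_word x : exists2 u : seq 'I_n, wprod u = x & ninv x = (size u).*2.
Proof.
have [m hm] := ubnP (ninv x); elim: m x hm => // m IHm x hm.
have [->|/exists_desc[i di]] := eqVneq x 1; first by exists [::]; rewrite ?ninv1 // /wprod big_nil.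
have := ninv_mul_sref x i; rewrite di => e.
have [|u xu nu] := IHm (x * sref i); first by rewrite /= in e *; lia.
exists (rcons u i); first by rewrite wprod_rcons xu -mulgA sref_sref mulg1.
by rewrite size_rcons; rewrite /= in e *; lia.
Qed.

Lemma ninv_down x d : d.*2 <= ninv x -> exists y, ninv y = d.*2.
Proof.
have [m hm] := ubnP (ninv x); elim: m x hm => // m IHm x hm.
rewrite leq_eqVlt => /orP[/eqP ->|lt]; first by exists x.
have [i di] : exists i, desc x i.
  by apply: exists_desc; apply: contraTneq lt => ->; rewrite ninv1.
have := ninv_mul_sref x i; rewrite di /= => e; apply: (IHm (x * sref i)).
  by move: hm; rewrite ltnS; lia.
by have [u _ ux] := ninv_word x; rewrite ux in e lt; lia.
Qed.

(** Guarantees that the search in [len] succeeds: every smaller even inversion count is attained by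
    some element, and these elements are distinct. *)
Lemma ninv_lt_card x : ninv x < #|{: W n}|.*2.
Proof.
have [u _ ux] := ninv_word x; rewrite ux ltn_double.
have : size (iota 0 (size u).+1) <= size [seq (ninv y)./2 | y : W n].
  apply: uniq_leq_size; first exact: iota_uniq.
  move=> d; rewrite mem_iota add0n ltnS => /= du.
  have [|y yd] := @ninv_down x d; first by rewrite ux leq_double.
  by apply/mapP; exists y; rewrite ?mem_enum // yd doubleK.
by rewrite size_iota size_map -cardE.
Qed.

Lemma len_ninv x : (len x).*2 = ninv x.
Proof.
have [u ux nu] := ninv_word x; have := ninv_lt_card x; rewrite nu ltn_double => lt.
congr _.*2; rewrite /len; set P := (fun _ => _).
have Pu : P (size u) by apply/existsP; exists (in_tuple u); rewrite ux.
have hs : has P (iota 0 #|{: W n}|) by apply/hasP; exists (size u); rewrite ?mem_iota.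
have := nth_find 0 hs; move: (hs); rewrite has_find size_iota => fl.
rewrite nth_iota // add0n => /existsP[v /eqP vx].
apply/eqP; rewrite eqn_leq; apply/andP; split; last first.
  by rewrite -leq_double -nu -vx; have := ninv_wprod v; rewrite size_tuple.
rewrite leqNgt.
apply/negP => /(before_find 0); rewrite nth_iota // add0n /P => /negbT/negP; apply.
exact: Pu.
Qed.

Lemma len1 : len (1 : W n) = 0.
Proof. by apply: double_inj; rewrite len_ninv ninv1. Qed.

Lemma len_eq0 x : (len x == 0) = (x == 1).
Proof.
apply/eqP/eqP => [l0|->]; last exact: len1.
have [u ux nu] := ninv_word x; rewrite -ux; move: nu; rewrite -len_ninv l0.
by case: u {ux} => //; rewrite /wprod big_nil.
Qed.

Lemma len_word x : exists2 u : seq 'I_n, wprod u = x & len x = size u.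
Proof.
by have [u ux] := ninv_word x; rewrite -len_ninv => /double_inj; exists u.
Qed.

Lemma len_wprod (u : seq 'I_n) : len (wprod u) <= size u.
Proof. by rewrite -leq_double len_ninv ninv_wprod. Qed.

Lemma wprod_cat (u v : seq 'I_n) : wprod (u ++ v) = wprod u * wprod v.
Proof. by rewrite /wprod big_cat. Qed.

Lemma len_mul x y : len (x * y) <= len x + len y.
Proof.
have [u <- ->] := len_word x; have [v <- ->] := len_word y.
by rewrite -wprod_cat -size_cat len_wprod.
Qed.

Lemma wprod_rev (u : seq 'I_n) : wprod (rev u) = (wprod u)^-1.
Proof.
elim: u => [|i u IHu]; first by rewrite /wprod big_nil invg1.
by rewrite rev_cons wprod_rcons IHu wprod_cons invMg srefV.
Qed.

Lemma len_inv x : len x^-1 = len x.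
Proof.
have le y : len y^-1 <= len y.
  by have [u <- ->] := len_word y; rewrite -wprod_rev -size_rev len_wprod.
by apply/eqP; rewrite eqn_leq le /=; have := le x^-1; rewrite invgK.
Qed.

Lemma len_sref i : len (sref i) = 1%N.
Proof. by apply: double_inj; rewrite len_ninv ninv_sref. Qed.

Lemma len_mulr x i : len (x * sref i) + (desc x i).*2 = (len x).+1.
Proof. by apply: double_inj; rewrite doubleD !len_ninv ninv_mul_sref doubleS len_ninv. Qed.

Lemma len_mull x i : len (sref i * x) + (desc x^-1 i).*2 = (len x).+1.
Proof. by rewrite -len_inv invMg srefV len_mulr len_inv. Qed.

Lemma desc_len x i : desc x i = (len (x * sref i) < len x).
Proof. by have := len_mulr x i; case: desc => /=; lia. Qed.

Lemma ldesc_len x i : desc x^-1 i = (len (sref i * x) < len x).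
Proof. by have := len_mull x i; case: desc => /=; lia. Qed.

Lemma undoneP x y :
  reflect (forall a b, a < b -> y b < y a -> x (y b) < x (y a)) (undone x y == 0).
Proof.
rewrite /undone sum_nat_eq0; apply: (iffP forallP) => [h|h a].
  have key a b : a < b -> y b < y a -> (a : nat) != n -> (b : nat) != n -> x (y b) < x (y a).
    move=> ab yab an bn; have := h a; rewrite sum_nat_eq0 => /forallP/(_ b).
    rewrite ab yab /= muln_eq0 eqb0 -leqNgt leq_eqVlt => /orP[/orP[/eqP e|->]//|].
      have /wperm_inj/wperm_inj ee := ord_inj e; by rewrite ee ltnn in ab.
    rewrite /wt !ord_eqE !val_rev; have := ltn_ord a; have := ltn_ord b; lia_ifs.
  (* Pairs through 0 weigh nothing in [undone], so they are recovered from the symmetric pair (-b,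
     b), or (a, -a), whose weight is 2. *)
  move=> a b ab yab; have [an|an] := eqVneq (a : nat) n.
    have bn : (b : nat) != n by lia.
    have := key (rev_ord b) b; rewrite !wrev !val_rev.
    move: yab; rewrite (wctr y an) (wctr x (wctr y an)).
    by have := ltn_ord b; have := ltn_ord (y b); have := ltn_ord (x (y b)); lia.
  have [bn|bn] := eqVneq (b : nat) n; last exact: key.
  have := key a (rev_ord a); rewrite !wrev !val_rev.
  move: yab; rewrite (wctr y bn) (wctr x (wctr y bn)).
  by have := ltn_ord a; have := ltn_ord (y a); have := ltn_ord (x (y a)); lia.
rewrite sum_nat_eq0; apply/forallP => b; rewrite /= muln_eq0 eqb0.
by apply/orP; left; apply/negP => /and3P[ab yab]; have := h a b ab yab; lia.
Qed.

Lemma len_mulP x y :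
  reflect (forall a b, a < b -> y b < y a -> x (y b) < x (y a))
          (len (x * y) == len x + len y).
Proof.
have -> : (len (x * y) == len x + len y) = (undone x y == 0).
  by have := ninv_mul x y; rewrite -!len_ninv; lia.
exact: undoneP.
Qed.

End Length.

(** * Classes and parabolic subgroups *)

Section Classes.
Variable n : nat.
Implicit Types (w x y z u : W n) (a b c : X n) (i j : 'I_n) (I J K M : {set 'I_n}).

(* The gap between v and v + 1 belongs to J if the corresponding reflection does. *)
Definition ingap J (v : nat) : bool :=
  [exists j in J, (v == n + j) || ((v + j).+1 == n)].

Lemma ingap_pos J j : ingap J (n + j) = (j \in J).
Proof.
apply/existsP/idP => [[i /andP[iJ e]]|jJ]; last by exists j; rewrite jJ eqxx.
by rewrite (_ : j = i) //; apply: ord_inj; have := ltn_ord j; lia.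
Qed.

Lemma ingap_neg J j v : (v + j).+1 = n -> ingap J v = (j \in J).
Proof.
move=> e; apply/existsP/idP => [[i /andP[iJ ei]]|jJ]; last by exists j; rewrite jJ e eqxx orbT.
by rewrite (_ : j = i) //; apply: ord_inj; lia.
Qed.

Lemma ingap_rev J v t : (v + t).+1 = n.*2 -> ingap J v = ingap J t.
Proof.
move=> e; rewrite /ingap; apply: eq_existsb => j; congr (_ && _).
by apply/idP/idP => h; have := ltn_ord j; lia.
Qed.

Lemma gap_index v : v < n.*2 -> exists j, ingap [set j] v.
Proof.
move=> lt; have [nv|vn] := leqP n v.
  have h : v - n < n by lia.
  exists (Ordinal h); have := ingap_pos [set Ordinal h] (Ordinal h).
  by rewrite /= subnKC // inE eqxx.
have h : n.-1 - v < n by lia.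
by exists (Ordinal h); rewrite (@ingap_neg _ (Ordinal h)) ?inE //=; lia.
Qed.

Lemma ingap1_eq j v : ingap [set j] v -> (v = n + j \/ (v + j).+1 = n)%N.
Proof. by case/existsP => i /andP[/set1P -> ]; lia. Qed.

Lemma ingap_index J j v : ingap [set j] v -> ingap J v = (j \in J).
Proof. by case/ingap1_eq => [->|]; [exact: ingap_pos | exact: ingap_neg]. Qed.

(** Classes are contiguous, so this is the number of classes below that of v, that is, its label
    shifted by k. *)
Definition clv J (v : nat) : nat := \sum_(0 <= g < v) ~~ ingap J g.

Lemma clvS J v : clv J v.+1 = clv J v + ~~ ingap J v.
Proof. by rewrite /clv big_nat_recr. Qed.

Lemma clv_mono J v t : v <= t -> clv J v <= clv J t.
Proof.
move=> /subnKC <-; elim: (t - v) => [|d IHd]; first by rewrite addn0.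
by rewrite addnS clvS (leq_trans IHd) // leq_addr.
Qed.

Lemma clv_rev J v : v <= n.*2 -> clv J (n.*2 - v) + clv J v = clv J n.*2.
Proof.
elim: v => [|v IHv] lt; first by rewrite subn0 {2}/clv big_nil addn0.
rewrite -IHv ?(ltnW lt) // clvS (@ingap_rev J v (n.*2 - v.+1)); last by lia.
have -> : n.*2 - v = (n.*2 - v.+1).+1 by lia.
by rewrite clvS; lia.
Qed.

Lemma clv_mid J : clv J n = n - #|J|.
Proof.
rewrite /clv big_nat_rev /= big_mkord.
transitivity (\sum_(i < n) (i \in ~: J : nat)).
  by apply: eq_bigr => i _; rewrite inE (@ingap_neg _ i) //; have := ltn_ord i; lia.
by rewrite -big_mkcond /= sum1_card cardsCs setCK card_ord.
Qed.

Lemma clv_all J : clv J n.*2 = (n - #|J|).*2.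
Proof. by rewrite -(@clv_rev J n) -?addnn ?leq_addr // addnK clv_mid addnn. Qed.

Lemma gap_refl J a b : b = a.+1 :> nat -> ingap J a ->
  exists2 j, j \in J & (a = lo j /\ b = hi j) \/ (a = rev_ord (hi j) /\ b = rev_ord (lo j)).
Proof.
move=> ab /existsP[j /andP[jJ e]]; exists j => //; have := ltn_ord j => ltj.
have [/eqP an|an] := boolP (a == n + j :> nat); [left | right];
  split; apply: ord_inj; rewrite ?val_rev ?lo_val ?hi_val; lia.
Qed.

Definition rising J (f : X n -> nat) : Prop :=
  forall a b, b = a.+1 :> nat -> ingap J a -> f a < f b.

Lemma class_rel J (R : X n -> X n -> Prop) a b :
  (forall c d e, R c d -> R d e -> R c e) ->
  (forall c d : X n, d = c.+1 :> nat -> ingap J c -> R c d) ->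
  a < b -> clv J a = clv J b -> R a b.
Proof.
move=> trR stepR ab cab; have [d] : {d | (a + d).+1 = b :> nat} by exists (b - a.+1); lia.
elim: d b {ab} cab => [|d IHd] b cab ab.
  apply: stepR; first by lia.
  by move: cab; rewrite -ab addn0 clvS; case: ingap => //=; lia.
have ltc : a + d.+1 < n.*2.+1 by have := ltn_ord b; lia.
have := clv_mono J (leqnSn (Ordinal ltc)); rewrite /= ab.
have : clv J a <= clv J (Ordinal ltc) by apply: clv_mono => /=; lia.
rewrite cab => h1 h2; have e : clv J (Ordinal ltc) = clv J b by apply/eqP; rewrite eqn_leq h2.
apply: (trR _ (Ordinal ltc)); first by apply: IHd => //=; [rewrite e | lia].
apply: stepR => //=.
by move: e; rewrite -ab /= clvS; case: ingap => //=; lia.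
Qed.

Lemma rising_lt J f a b : rising J f -> a < b -> clv J a = clv J b -> f a < f b.
Proof. by apply: (@class_rel J (fun c d => f c < f d)) => c d e; exact: ltn_trans. Qed.

Lemma risingP J x : (forall j, j \in J -> ~~ desc x j) <-> rising J (fun a => x a).
Proof.
split=> [h a b ab /(gap_refl ab)[j jJ [[-> ->]|[-> ->]]]|h j jJ].
- by rewrite -ndesc h.
- by rewrite wlt_neg -ndesc h.
by rewrite ndesc; apply: h; rewrite ?hi_val ?lo_val ?ingap_pos.
Qed.

(** As x(-a) = -x(a), falling on classes is rising after negation, so [rising_lt] serves both
    cases. *)
Lemma fallingP J x :
  (forall j, j \in J -> desc x j) <-> rising J (fun a => x (rev_ord a)).
Proof.
split=> [h a b ab /(gap_refl ab)[j jJ [[-> ->]|[-> ->]]]|h j jJ].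
- by rewrite wlt_neg; exact: h.
- by rewrite !rev_ordK; exact: h.
by rewrite /desc -wlt_neg; apply: h; rewrite ?hi_val ?lo_val ?ingap_pos.
Qed.

Lemma falling_lt J x a b : (forall j, j \in J -> desc x j) ->
  a < b -> clv J a = clv J b -> x b < x a.
Proof.
by move/fallingP => r ab cab; rewrite -wlt_neg; exact: (rising_lt r).
Qed.

Lemma parabolic_ind J (P : W n -> Prop) :
  P 1 -> (forall j w, j \in J -> P w -> P (sref j * w)) ->
  forall w, w \in parabolic J -> P w.
Proof.
move=> P1 PM w /gen_prodgP[m [f fJ ->]].
elim: m f fJ => [|m IHm] f fJ; first by rewrite big_ord0.
rewrite big_ord_recl; have /imsetP[j jJ ->] := fJ ord0.
by apply: PM => //; apply: IHm => i; exact: fJ.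
Qed.

Lemma sref_parabolic J j : j \in J -> sref j \in parabolic J.
Proof. by move=> jJ; apply/mem_gen/imset_f. Qed.

Lemma clv_sref J j a : j \in J -> clv J (sref j a) = clv J a.
Proof.
move=> jJ; have ltj := ltn_ord j.
have ep : clv J (n + j).+1 = clv J (n + j) by rewrite clvS ingap_pos jJ addn0.
have en v : (v + j).+1 = n -> clv J v.+1 = clv J v by move=> e; rewrite clvS (ingap_neg _ e) jJ addn0.
have := sref_cases j a; cbv zeta; move: (nat_of_ord (sref j a)) (nat_of_ord a) => s v.
case: (nat_of_ord j) ltj ep en => [|i] ltj ep en.
  have e0 : clv J n.+1 = clv J n.-1.
    have e1 : n.-1.+1 = n by lia.
    by have := en n.-1; rewrite addn0 e1 => <- //; move: ep; rewrite !addn0.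
  case=> [[e ->]|[-> e]|[_ _ ->]] //; first by rewrite e0; congr clv; lia.
  by rewrite e0; congr clv; lia.
case=> [[-> ->]//|[[-> ->]//|]].
case=> [[e1 e2]|[e1 ->]|[-> _]] //; last exact: en.
by rewrite -e2 en //; lia.
Qed.

Lemma clv_parabolic J w a : w \in parabolic J -> clv J (w a) = clv J a.
Proof.
by move=> wJ; elim/parabolic_ind: wJ => [|j {}w jJ <-]; rewrite ?wone_id // wmulE clv_sref.
Qed.

(** Any descent of w lies in J: w preserves classes, and the two sides of a gap outside J are in
    different classes, whose order is kept. *)
Lemma parabolic_desc J w : w \in parabolic J -> w != 1 -> exists2 j, j \in J & desc w j.
Proof.
move=> wJ /exists_desc[i di]; exists i => //; apply: contraLR di => iJ; rewrite ndesc.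
rewrite ltnNge; apply/negP => /(clv_mono J); rewrite !clv_parabolic // lo_val hi_val.
by rewrite clvS ingap_pos iJ; lia.
Qed.

Lemma parabolic_inversion J w a b : w \in parabolic J -> a < b -> w b < w a ->
  clv J a = clv J b.
Proof.
move=> wJ ab wab; have := clv_mono J (ltnW ab); have := clv_mono J (ltnW wab).
by rewrite !clv_parabolic //; lia.
Qed.

(** Pairs inverted by u lie inside one class of J, where x keeps the order, so x undoes nothing. *)
Lemma rising_len J x u : (forall j, j \in J -> ~~ desc x j) -> u \in parabolic J ->
  len (x * u) = len x + len u.
Proof.
move=> /risingP rx uJ; apply/eqP/len_mulP => a b ab uab.
apply: (rising_lt rx uab); rewrite !clv_parabolic //.
by rewrite (parabolic_inversion uJ ab uab).
Qed.

Lemma rising_uniq J x u : (forall j, j \in J -> ~~ desc x j) -> u \in parabolic J ->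
  (forall j, j \in J -> ~~ desc (x * u) j) -> u = 1.
Proof.
move=> /risingP rx uJ rxu; apply/eqP; apply/idPn => /(parabolic_desc uJ)[j jJ dj].
have := rxu j jJ; rewrite /desc !wmulE => /negP; apply.
apply: (rising_lt rx dj); rewrite !clv_parabolic // lo_val hi_val.
by rewrite clvS ingap_pos jJ addn0.
Qed.

Lemma longest_in J : longest J \in parabolic J.
Proof. by rewrite /longest; case: arg_maxnP => //; exact: group1. Qed.

Lemma longest_max J u : u \in parabolic J -> len u <= len (longest J).
Proof. by rewrite /longest; case: arg_maxnP => [|w _ h /h //]; exact: group1. Qed.

Lemma longest_desc J j : j \in J -> desc (longest J) j.
Proof.
move=> jJ; apply/idPn => nd; have := len_mulr (longest J) j; rewrite (negbTE nd) /=.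
have := @longest_max J (longest J * sref j).
by rewrite groupM ?longest_in ?sref_parabolic // => /(_ isT); lia.
Qed.

(** Such a u reverses the order in each class. A descent of u^-1 w_J in J would thus become an
    ascent of w_J. *)
Lemma longest_uniq J u : u \in parabolic J -> (forall j, j \in J -> desc u j) -> u = longest J.
Proof.
move=> uJ du; have vJ : u^-1 * longest J \in parabolic J by rewrite groupM ?groupV ?longest_in.
suff v1 : u^-1 * longest J = 1 by rewrite -(mulKVg u (longest J)) v1 mulg1.
apply/eqP; apply/idPn => /(parabolic_desc vJ)[j jJ dv].
have := longest_desc jJ; rewrite /desc -{1 2}(mulKVg u (longest J)) ![(u * _) _]wmulE.
have := falling_lt du dv; rewrite !clv_parabolic // lo_val hi_val clvS ingap_pos jJ addn0.
by move=> /(_ erefl) h1 h2; have := ltn_trans h1 h2; rewrite ltnn.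
Qed.

Lemma longestV J : (longest J)^-1 = longest J.
Proof.
have wJ : (longest J)^-1 \in parabolic J by rewrite groupV longest_in.
apply: longest_uniq => // j jJ; rewrite ldesc_len.
have := len_mull (longest J) j; case: (desc _ j) (ldesc_len (longest J) j) => /=.
  by move=> <-.
have := @longest_max J (sref j * longest J).
by rewrite groupM ?longest_in ?sref_parabolic // => /(_ isT); lia.
Qed.

Lemma longestK J : longest J * longest J = 1.
Proof. by rewrite -{1}longestV mulVg. Qed.

(** [longest J] reverses each class. A point strictly between the images of a and b would be in
    their class, and its preimage would have to lie strictly between the consecutive points a and
    b. *)
Lemma longest_gap J a b : b = a.+1 :> nat -> ingap J a ->
  longest J a = (longest J b).+1 :> nat /\ ingap J (longest J b).
Proof.
move=> ab gJ; set w := longest J.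
have cab : clv J a = clv J b by rewrite ab clvS gJ addn0.
have wba : w b < w a by apply: (falling_lt (@longest_desc J)) => //; rewrite ab.
have adj : w a = (w b).+1 :> nat.
  apply/eqP; rewrite eqn_leq wba andbT leqNgt; apply/negP => gap.
  have lt : (w b).+1 < n.*2.+1 by have := ltn_ord (w a); lia.
  pose v : X n := Ordinal lt; pose c := w^-1 v.
  have wc : w c = v by rewrite /c wVK.
  have cv : clv J c = clv J v by rewrite -wc clv_parabolic ?longest_in.
  have h1 : clv J (w b) <= clv J v by apply: clv_mono => /=.
  have h2 : clv J v <= clv J (w a) by apply: clv_mono => /=; lia.
  rewrite !clv_parabolic ?longest_in // in h1 h2.
  have cva : clv J c = clv J a by lia.
  case: (ltngtP c a) => [ca|ac|/ord_inj ca].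
  - by have := falling_lt (@longest_desc J) ca cva; rewrite -/w wc /=; lia.
  - have : b <= c by lia.
    rewrite leq_eqVlt => /orP[/eqP/ord_inj bc|bc]; first by move: wc => /(congr1 (@nat_of_ord _)); rewrite -bc /=; lia.
    have := falling_lt (@longest_desc J) bc; rewrite cva cab => /(_ erefl).
    by rewrite -/w wc /=; lia.
  by move: wc => /(congr1 (@nat_of_ord _)); rewrite ca /=; lia.
split=> //; have : clv J (w a) = clv J (w b) by rewrite !clv_parabolic ?longest_in.
by rewrite adj clvS; case: ingap => //=; lia.
Qed.

End Classes.

(** * Block permutations *)

Section Blocks.
Variable n : nat.
Implicit Types (w x y z u : W n) (a b c : X n) (i j : 'I_n) (I J K M : {set 'I_n}).

Definition adj i a b : bool :=
  (b == a.+1 :> nat) && ingap [set i] a || (a == b.+1 :> nat) && ingap [set i] b.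

(** The reflection of a gap, written through its end points and negation only, so that any signed
    permutation transports it. If one end is 0 the reflection negates the other; otherwise it
    exchanges a with b and -a with -b. *)
Definition swap_gap a b c : X n :=
  if (rev_ord a == a) || (rev_ord b == b) then
    if [|| c == a, c == b, c == rev_ord a | c == rev_ord b] then rev_ord c else c
  else if c == a then b else if c == b then a
  else if c == rev_ord a then rev_ord b else if c == rev_ord b then rev_ord a else c.

Lemma adjE i a b : adj i a b ->
  [\/ b = a.+1 :> nat /\ a = n + i :> nat, b = a.+1 :> nat /\ (a + i).+1 = n |
     (a = b.+1 :> nat /\ b = n + i :> nat) \/ (a = b.+1 :> nat /\ (b + i).+1 = n)].
Proof.
case/orP => /andP[/eqP e /ingap1_eq[h|h]]; [constructor 1|constructor 2|constructor 3; left|constructor 3; right];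
  by split.
Qed.

Lemma sref_adj i a b c : adj i a b -> sref i c = swap_gap a b c.
Proof.
move=> ad; apply: ord_inj.
have -> : nat_of_ord (swap_gap a b c) = (
  if (rev_ord a == a) || (rev_ord b == b) then
    if [|| c == a, c == b, c == rev_ord a | c == rev_ord b] then nat_of_ord (rev_ord c)
    else nat_of_ord c
  else if c == a then nat_of_ord b else if c == b then nat_of_ord a
  else if c == rev_ord a then nat_of_ord (rev_ord b)
  else if c == rev_ord b then nat_of_ord (rev_ord a) else nat_of_ord c).
  by rewrite /swap_gap; do !case: ifP.
rewrite !ord_eqE !val_rev; have := sref_cases i c; cbv zeta.
have := ltn_ord i; have := ltn_ord a; have := ltn_ord b; have := ltn_ord c.
move/adjE: ad.
move: (nat_of_ord (sref i c)) (nat_of_ord a) (nat_of_ord b) (nat_of_ord c) => s {}a {}b {}c.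
case: (nat_of_ord i) => [|{}i] adj hc hb ha hi hs; split_hyps; subst; lia_ifs.
Qed.

Lemma swap_gap_act x a b c : x (swap_gap a b c) = swap_gap (x a) (x b) (x c).
Proof.
by rewrite /swap_gap -!wrev !(inj_eq (@wperm_inj _ x)); do !case: ifP => _; rewrite ?wrev.
Qed.

Lemma conj_sref x i j a b : adj j a b -> adj i (x a) (x b) -> x * sref j = sref i * x.
Proof.
move=> adj_ab adj_xab; apply: wperm_ext => c.
by rewrite !wmulE (sref_adj _ adj_ab) (sref_adj _ adj_xab) swap_gap_act.
Qed.

Lemma adj_lohi i : adj i (lo i) (hi i).
Proof. by rewrite /adj hi_val lo_val eqxx ingap_pos inE eqxx. Qed.

(** Converse of [conj_sref] for x rising at j. If j = 0, then s_i negates the nonzero point x(1),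
    which forces i = 0 and x(1) = 1. Otherwise s_i exchanges two points that are not opposite, so
    they bound its gap or the mirror gap. *)
Lemma conj_gap x i j : ~~ desc x j -> x * sref j = sref i * x ->
  x (hi j) = (x (lo j)).+1 :> nat /\ ingap [set i] (x (lo j)).
Proof.
rewrite ndesc => up e.
have e1 : sref i (x (hi j)) = x (sref j (hi j)) by rewrite -!wmulE e.
have [j0|j0] := eqVneq (j : nat) 0.
  have xl : x (lo j) = n :> nat by apply: wctr; rewrite lo_val j0 addn0.
  have := sref_cases i (x (hi j)); rewrite e1 sref_hi0 // wrev val_rev xl; cbv zeta.
  rewrite xl in up; have := ltn_ord (x (hi j)); have := ltn_ord i.
  have {1}-> : ingap [set i] n = ((i : nat) == 0).
    apply/idP/eqP => [/ingap1_eq|i0]; first by lia.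
    by have := ingap_pos [set i] i; rewrite i0 addn0 => ->; rewrite inE.
  move: (nat_of_ord (x (hi j))) up => v; case: (nat_of_ord i) => [|k] up h1 h2 h3; split_hyps; split; lia.
rewrite sref_hi // in e1.
have ne : x (hi j) <> rev_ord (x (lo j)) :> nat.
  by rewrite -wrev => /ord_inj/wperm_inj/(congr1 (@nat_of_ord _)); rewrite val_rev hi_val lo_val; lia.
have := sref_cases i (x (hi j)); rewrite e1; move: ne; rewrite val_rev; cbv zeta.
have g1 v : v = n + i -> ingap [set i] v by move=> ->; rewrite ingap_pos inE.
have g2 v : (v + i).+1 = n -> ingap [set i] v by move=> h; rewrite (ingap_neg _ h) inE.
move: g1 g2 up; move: (nat_of_ord (x (hi j))) (nat_of_ord (x (lo j))) => v u g1 g2 up.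
have := ltn_ord i; move: g1 g2.
by case: (nat_of_ord i) => [|k] g1 g2 hi ne h; split_hyps; try lia; split; try lia;
  first [apply: g1; lia | apply: g2; lia].
Qed.

(** This local form composes at once. That classes of J go onto whole classes of I comes from equal
    cardinals, through [blk_inv]. *)
Definition blk I J x : Prop :=
  forall a b, b = a.+1 :> nat -> ingap J a -> x b = (x a).+1 :> nat /\ ingap I (x a).

Lemma blk1 J : blk J J 1.
Proof. by move=> a b ab g; rewrite !wone_id. Qed.

Lemma blk_mul I J K x y : blk I J x -> blk J K y -> blk I K (x * y).
Proof. by move=> bx yb a b ab /(yb a b ab)[h1 h2]; rewrite !wmulE; exact: bx. Qed.

Lemma blk_desc I J x j : blk I J x -> j \in J -> ~~ desc x j.
Proof.
move=> bx jJ; rewrite ndesc; have [||-> //] := bx (lo j) (hi j); rewrite ?lo_val ?hi_val //.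
by rewrite ingap_pos.
Qed.

Lemma blk_conj I J x j : blk I J x -> j \in J ->
  exists2 i, i \in I & x * sref j = sref i * x.
Proof.
move=> bx jJ; have [||e g] := bx (lo j) (hi j); rewrite ?lo_val ?hi_val ?ingap_pos //.
have [|i gi] := @gap_index n (x (lo j)); first by have := ltn_ord (x (hi j)); lia.
exists i; first by rewrite -(ingap_index I gi).
by apply: conj_sref (adj_lohi j) _; rewrite /adj e eqxx gi.
Qed.

Lemma blk_set I J x : blk I J x -> #|I| = #|J| ->
  [set sref i | i in I] = [set sref j | j in J] :^ x^-1.
Proof.
move=> bx cIJ; apply/esym/eqP; rewrite eqEcard cardJg !card_imset ?cIJ ?leqnn ?andbT; try exact: sref_inj.
apply/subsetP => t; rewrite mem_conjg invgK => /imsetP[j jJ e].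
have [i iI c] := blk_conj bx jJ; apply/imsetP; exists i => //.
by rewrite -[t](conjgK x) e conjgE invgK mulgA c mulgK.
Qed.

(** Turns the definition of a core coset, an equality of sets of conjugates, into [blk]; the
    cardinals agree because conjugation and [sref] are injective. *)
Lemma set_blk I J x : [set sref i | i in I] = [set sref j | j in J] :^ x^-1 ->
  (forall j, j \in J -> ~~ desc x j) -> blk I J x /\ #|I| = #|J|.
Proof.
move=> e up; have cIJ : #|I| = #|J|.
  by rewrite -(card_imset _ (@sref_inj n)) e cardJg card_imset //; exact: sref_inj.
split=> // a b ab /(gap_refl ab)[j jJ abj].
have : sref j ^ x^-1 \in [set sref i | i in I] by rewrite e memJ_conjg imset_f.
case/imsetP => i iI; rewrite conjgE invgK mulgA => c.
have [|h1 h2] := @conj_gap x i j (up j jJ); first by rewrite -c mulgKV.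
have g : ingap I (x (lo j)) by rewrite (ingap_index I h2).
case: abj => [[-> ->]|[-> ->]] //; rewrite !wrev !val_rev h1; split.
  by have := ltn_ord (x (hi j)); lia.
by rewrite (@ingap_rev _ I _ (x (lo j))) //; have := ltn_ord (x (hi j)); lia.
Qed.

Lemma blk_inv I J x : blk I J x -> #|I| = #|J| -> blk J I x^-1.
Proof.
move=> bx cIJ; have e := blk_set bx cIJ.
have [||//] := @set_blk J I x^-1; first by rewrite e -conjsgM mulgV conjsg1.
move=> i iI; have : sref i \in [set sref j | j in J] :^ x^-1 by rewrite -e imset_f.
rewrite mem_conjg invgK => /imsetP[j jJ c].
have {}c : x * sref j = sref i * x by rewrite -c conjgE !mulgA mulgV mul1g.
have [h1 h2] := conj_gap (blk_desc bx jJ) c; rewrite ndesc.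
have [i' /set1P -> [[e1 e2]|[e1 e2]]] := gap_refl h1 h2.
  by rewrite -e1 -e2 !wK lo_val hi_val.
rewrite -wlt_neg -e1 -e2 !wK lo_val hi_val //.
Qed.

Lemma blk_clv I J x a b : blk I J x -> clv J a = clv J b -> clv I (x a) = clv I (x b).
Proof.
move=> bx; wlog ab : a b / a < b.
  move=> IH cab; case: (ltngtP a b) => [lt|lt|/ord_inj -> //]; first exact: IH.
  by apply/esym/IH.
apply: (@class_rel _ J (fun c d => clv I (x c) = clv I (x d))) ab => [c d e -> //|c d cd gc].
by have [-> g] := bx c d cd gc; rewrite clvS g addn0.
Qed.

End Blocks.

(** * Double cosets and their composition *)

Section Cosets.
Variable n : nat.
Implicit Types (w x y z u : W n) (a b c : X n) (i j : 'I_n) (I J K M : {set 'I_n}).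
Implicit Types p q : dcoset n.

Lemma bruhat_left x i : desc x^-1 i -> bruhat (sref i * x) x.
Proof.
rewrite ldesc_len => lt; apply/connect1; rewrite /= lt; apply/existsP; exists (sref i).
rewrite mulgA sref_sref mul1g eqxx andbT; apply/existsP; exists 1; apply/existsP; exists i.
by rewrite invg1 mul1g mulg1.
Qed.

Lemma bruhat_right x i : desc x i -> bruhat (x * sref i) x.
Proof.
rewrite desc_len => lt; apply/connect1; rewrite /= lt; apply/existsP; exists (x * sref i * x^-1).
rewrite -!mulgA mulKg sref_sref mulg1 eqxx andbT; apply/existsP; exists x.
by apply/existsP; exists i; rewrite mulgA.
Qed.

Lemma bruhat_len x y : bruhat x y -> x = y \/ len x < len y.
Proof.
case/connectP => t; elim: t x => [|z t IHt] x /=; first by move=> _ ->; left.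
case/andP => /andP[lt _] /IHt h /h [<-|lt']; right; [exact: lt | exact: ltn_trans lt lt'].
Qed.

Lemma bruhat_anti x y : bruhat x y -> bruhat y x -> x = y.
Proof. by move=> /bruhat_len[//|h] /bruhat_len[//|h']; lia. Qed.

Lemma sref_inverted i a b : a < b -> sref i b < sref i a -> adj i a b \/ b = rev_ord a.
Proof.
move=> ab sab.
have [[e h]|[[e h]|e]] : (b = a.+1 :> nat /\ a = n + i :> nat) \/
    (b = a.+1 :> nat /\ (a + i).+1 = n) \/ b = n.*2 - a :> nat.
- move: ab sab; have := sref_cases i a; have := sref_cases i b; cbv zeta.
  have := ltn_ord i; have := ltn_ord a; have := ltn_ord b.
  move: (nat_of_ord (sref i a)) (nat_of_ord (sref i b)) (nat_of_ord a) (nat_of_ord b).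
  by move=> sa sb {}a {}b; case: (nat_of_ord i) => [|{}i] *; split_hyps; lia.
- by left; rewrite /adj e eqxx h ingap_pos inE eqxx.
- by left; rewrite /adj e eqxx (ingap_neg _ h) inE eqxx.
by right; apply: ord_inj; rewrite val_rev.
Qed.

(** Deodhar's lemma. If s_i x falls at j while x rises there, s_i inverts x(lo j) < x(hi j). These
    points are not opposite, because [lo j] and [hi j] are not, so they bound a gap of s_i and
    [conj_sref] applies. *)
Lemma deodhar J x i : (forall j, j \in J -> ~~ desc x j) ->
  (forall j, j \in J -> ~~ desc (sref i * x) j) \/
  (exists2 j, j \in J & sref i * x = x * sref j).
Proof.
move=> up; have [/existsP[j /andP[jJ dj]]|] := boolP [exists j in J, desc (sref i * x) j].
  right; exists j => //; have := up j jJ; rewrite ndesc => lt.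
  move: dj; rewrite /desc !wmulE => /(sref_inverted lt) [ad|].
    by rewrite -(conj_sref (adj_lohi j) ad).
  rewrite -wrev => /wperm_inj/(congr1 (@nat_of_ord _)); rewrite val_rev lo_val hi_val.
  by lia.
rewrite negb_exists => /forallP h; left=> j jJ.
by have := h j; rewrite jJ.
Qed.

(** By Deodhar's lemma each letter of x either extends u or crosses u y and joins v. *)
Lemma left_factor I J x y : (forall j, j \in J -> ~~ desc y j) -> x \in parabolic I ->
  exists u, exists v, [/\ u \in parabolic I, v \in parabolic J,
    x * y = u * y * v & forall j, j \in J -> ~~ desc (u * y) j].
Proof.
move=> up; elim/parabolic_ind => [|i {}x iI [u [v [uI vJ e upu]]]].
  by exists 1, 1; rewrite !group1 !mul1g mulg1.
have [h|[j jJ h]] := deodhar i upu.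
  exists (sref i * u), v; rewrite groupM ?sref_parabolic //.
  by rewrite -!mulgA e !mulgA; split=> // j jJ; rewrite -mulgA h.
exists u, (sref j * v); rewrite groupM ?sref_parabolic //; split=> //.
by rewrite -mulgA e !mulgA -[_ * u * y]mulgA h.
Qed.

Definition dmin I J x : Prop :=
  (forall i, i \in I -> ~~ desc x^-1 i) /\ (forall j, j \in J -> ~~ desc x j).

(** After [left_factor], [rising_uniq] removes the right factor, and then the left one on
    inverses. *)
Lemma dmin_uniq I J x u v : dmin I J x -> u \in parabolic I -> v \in parabolic J ->
  dmin I J (u * x * v) -> u * x * v = x.
Proof.
move=> [xI xJ] uI vJ [yI yJ]; have [u' [v' [uI' vJ' e up]]] := left_factor xJ uI.
rewrite e -mulgA in yI yJ *.
have v1 := rising_uniq up (groupM vJ' vJ) yJ; rewrite v1 mulg1 invMg in yI *.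
have := rising_uniq xI (groupVr uI') yI => /eqP; rewrite eq_invg1 => /eqP ->.
by rewrite mul1g.
Qed.

Lemma dcosetP I J x y :
  reflect (exists u, exists v, [/\ u \in parabolic I, v \in parabolic J & y = u * x * v])
          (y \in parabolic I * [set x] * parabolic J).
Proof.
apply: (iffP mulsgP) => [[t v /mulsgP[u s uI /set1P -> ->] vJ ->]|[u [v [uI vJ ->]]]].
  by exists u, v.
by exists (u * x) v => //; apply/mulsgP; exists u x => //; exact: set11.
Qed.

Lemma dcoset_eq I J x y : y \in parabolic I * [set x] * parabolic J ->
  parabolic I * [set x] * parabolic J = parabolic I * [set y] * parabolic J.
Proof.
case/dcosetP => u [v [uI vJ ->]].
by rewrite -!mulg_set1 !mulgA (rcoset_id uI) -(mulgA (_ * [set x]) [set v]) (lcoset_id vJ).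
Qed.

Lemma mk_dcosetE p x : x \in elts p -> p = mk_dcoset (lft p) (rgt p) x.
Proof.
case: p => [[[I J] P] pP]; rewrite /elts /lft /rgt /= => xp; apply: val_inj => /=.
by move: pP xp; rewrite /is_dcoset /= => /existsP[y /eqP ->] xp; rewrite (dcoset_eq xp).
Qed.

Lemma elts_mk I J x : x \in elts (mk_dcoset I J x).
Proof. by apply/dcosetP; exists 1, 1; rewrite !group1 mul1g mulg1. Qed.

Lemma elts_ex p : exists x, x \in elts p.
Proof.
case: p => [[[I J] P] pP]; have := pP; rewrite /is_dcoset /= => /existsP[x e].
exists x; rewrite /elts /=; move/eqP: e => ->; exact: (elts_mk I J x).
Qed.

Lemma eltsP p x y : x \in elts p ->
  reflect (exists u, exists v, [/\ u \in parabolic (lft p), v \in parabolic (rgt p) & y = u * x * v])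
          (y \in elts p).
Proof.
move=> xp; have -> : elts p = parabolic (lft p) * [set x] * parabolic (rgt p).
  by rewrite [in LHS](mk_dcosetE xp).
exact: dcosetP.
Qed.

Lemma elts_left p x i : x \in elts p -> i \in lft p -> sref i * x \in elts p.
Proof.
move=> xp ip; apply/(eltsP _ xp); exists (sref i), 1.
by rewrite group1 sref_parabolic // mulg1.
Qed.

Lemma elts_right p x i : x \in elts p -> i \in rgt p -> x * sref i \in elts p.
Proof.
move=> xp ip; apply/(eltsP _ xp); exists 1, (sref i).
by rewrite group1 sref_parabolic // mul1g.
Qed.

(** Removing left and right descents of y one at a time goes down in Bruhat order and ends at an
    element without descents on either side, which is x by [dmin_uniq]. *)
Lemma dmin_bruhat p x y : x \in elts p -> dmin (lft p) (rgt p) x -> y \in elts p -> bruhat x y.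
Proof.
move=> xp mx; have [m hm] := ubnP (len y); elim: m y hm => // m IHm y hm yp.
have [/existsP[i /andP[ip di]]|nl] := boolP [exists i in lft p, desc y^-1 i].
  apply: connect_trans (bruhat_left di); apply: IHm; last exact: elts_left.
  by rewrite ldesc_len in di; lia.
have [/existsP[i /andP[ip di]]|nr] := boolP [exists i in rgt p, desc y i].
  apply: connect_trans (bruhat_right di); apply: IHm; last exact: elts_right.
  by rewrite desc_len in di; lia.
have my : dmin (lft p) (rgt p) y.
  split=> i ip; [move: nl | move: nr]; rewrite negb_exists => /forallP/(_ i);
    by rewrite ip.
have [u [v [uI vJ e]]] := eltsP _ xp yp.
by rewrite e (dmin_uniq mx uI vJ) -?e // /bruhat connect0.
Qed.

Lemma dmin_ex p : exists2 x, x \in elts p & dmin (lft p) (rgt p) x.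
Proof.
have [x0 x0p] := elts_ex p; case: (arg_minnP (@len n) x0p) => x xp min.
exists x => //; split=> i ip; rewrite ?ldesc_len ?desc_len -leqNgt; apply: min.
  exact: elts_left.
exact: elts_right.
Qed.

Lemma minelE p x : x \in elts p -> dmin (lft p) (rgt p) x -> minel p = x.
Proof.
move=> xp mx; rewrite /minel; case: pickP => [y /andP[yp /forallP h]|/(_ x)] /=.
  apply: bruhat_anti; last exact: (dmin_bruhat xp).
  by have := h x; rewrite xp.
rewrite xp => /negbT/forallPn[y]; rewrite negb_imply => /andP[yp /negP[]].
exact: (dmin_bruhat xp).
Qed.

Lemma minel_in p : minel p \in elts p.
Proof. by have [x xp mx] := dmin_ex p; rewrite (minelE xp mx). Qed.

Lemma minel_dmin p : dmin (lft p) (rgt p) (minel p).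
Proof. by have [x xp mx] := dmin_ex p; rewrite (minelE xp mx). Qed.

Lemma coreP p : core p -> blk (lft p) (rgt p) (minel p) /\ #|lft p| = #|rgt p|.
Proof. by move/eqP/set_blk; apply; have [] := minel_dmin p. Qed.

Lemma blk_dmin I J x : blk I J x -> #|I| = #|J| -> dmin I J x.
Proof. by move=> bx c; split=> i iI; apply: blk_desc iI; [exact: (blk_inv bx c) | exact: bx]. Qed.

Lemma blk_core p x : x \in elts p -> blk (lft p) (rgt p) x -> #|lft p| = #|rgt p| ->
  minel p = x /\ core p.
Proof.
move=> xp bx c; have e := minelE xp (blk_dmin bx c); split=> //.
by rewrite /core e; apply/eqP/blk_set.
Qed.

Lemma blk_parabolic I J x u : blk I J x -> #|I| = #|J| -> u \in parabolic I ->
  exists2 v, v \in parabolic J & u * x = x * v.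
Proof.
move=> bx c; elim/parabolic_ind => [|i w iI [v vJ e]].
  by exists 1; rewrite ?group1 // mul1g mulg1.
have [j jJ h] := blk_conj (blk_inv bx c) iI.
exists (sref j * v); first by rewrite groupM ?sref_parabolic.
rewrite -mulgA e !mulgA; congr (_ * _).
by rewrite -[LHS]mul1g -(mulgV x) -!mulgA; congr (_ * _); rewrite !mulgA h mulgKV.
Qed.

(** By [blk_parabolic] every element of p is x u with u in W_J. Multiplying u by its ascents in J
    climbs to w_J, and each step is a Bruhat step for x u because lengths add. *)
Lemma maxel_core p : core p -> maxel p = minel p * longest (rgt p).
Proof.
move=> cp; have [bx c] := coreP cp; set x := minel p in bx *; set J := rgt p in bx c *.
have xJ j : j \in J -> ~~ desc x j by exact: (blk_desc bx).
have inp u : u \in parabolic J -> x * u \in elts p.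
  by move=> uJ; apply/(eltsP _ (minel_in p)); exists 1, u; rewrite group1 mul1g.
have ub u : u \in parabolic J -> bruhat (x * u) (x * longest J).
  have [m hm] := ubnP (len (longest J) - len u); elim: m u hm => // m IHm u hm uJ.
  have [/existsP[j /andP[jJ nd]]|] := boolP [exists j in J, ~~ desc u j].
    have usJ : u * sref j \in parabolic J by rewrite groupM ?sref_parabolic.
    have lu := len_mulr u j; rewrite (negbTE nd) /= in lu.
    have le := longest_max usJ.
    apply: connect_trans (IHm _ _ usJ); last by lia.
    have := @bruhat_right (x * (u * sref j)) j; rewrite -!mulgA sref_sref mulg1; apply.
    rewrite desc_len -!mulgA sref_sref mulg1 !(rising_len xJ) //; lia.
  rewrite negb_exists => /forallP h; rewrite (@longest_uniq _ J u) //; first exact: connect0.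
  by move=> j jJ; have := h j; rewrite jJ negbK.
have {}ub y : y \in elts p -> bruhat y (x * longest J).
  move/(eltsP _ (minel_in p)) => [u [v [uI vJ ->]]]; rewrite -/x.
  by have [v' vJ' ->] := blk_parabolic bx c uI; rewrite -mulgA; exact: ub (groupM vJ' vJ).
rewrite /maxel; case: pickP => [y /andP[yp /forallP h]|/(_ (x * longest J))] /=.
  apply: bruhat_anti; first exact: ub.
  by have := h (x * longest J); rewrite inp ?longest_in.
rewrite inp ?longest_in //= => /negbT/forallPn[y]; rewrite negb_imply => /andP[yp /negP[]].
exact: ub.
Qed.

Lemma reduced_wordP w : wprod (reduced_word w) = w /\ size (reduced_word w) = len w.
Proof.
rewrite /reduced_word; case: pickP => [t /eqP tw|]; first by rewrite size_tuple.
by have [u uw lu] := len_word w; move/(_ (tcast (esym lu) (in_tuple u))); rewrite val_tcast uw eqxx.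
Qed.

(** Induction on a reduced word of x u. By Deodhar's lemma its first letter s_i either shortens x,
    and then multiplies with increasing length, or satisfies s_i x = x s_j. In that case it belongs
    to u, and it fixes x y under the star action since s_j is a left descent of y. *)
Lemma star_rising J x u y : (forall j, j \in J -> ~~ desc x j) -> u \in parabolic J ->
  (forall j, j \in J -> desc y^-1 j) -> len (x * y) = len x + len y ->
  star (x * u) y = x * y.
Proof.
move=> xJ uJ dy lxy; rewrite /star; have [] := reduced_wordP (x * u).
move: (reduced_word (x * u)) => r; elim: r x u xJ uJ lxy => [|i r IHr] x u xJ uJ lxy.
  rewrite /wprod big_nil => /esym xu1 _ /=.
  have := rising_len xJ uJ; rewrite xu1 len1 => /esym/eqP; rewrite addn_eq0 len_eq0.
  by case/andP => /eqP -> _; rewrite mul1g.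
rewrite wprod_cons /= => e lr.
have {}e : wprod r = sref i * (x * u) by rewrite -e mulgA sref_sref mul1g.
have lr' : size r = len (sref i * (x * u)).
  have := len_wprod r; rewrite e; have := len_mull (x * u) i; rewrite -lr.
  by case: desc => /=; lia.
have [h|[j jJ h]] := deodhar i xJ.
  rewrite mulgA in e lr'.
  have l1 : len x = (len (sref i * x)).+1.
    have e1 := rising_len xJ uJ; have e2 := rising_len h uJ.
    by rewrite -lr in e1; rewrite -lr' in e2; lia.
  have l2 : len (sref i * x * y) = len (sref i * x) + len y.
    apply/eqP; rewrite eqn_leq len_mul /=.
    have : len (sref i * (sref i * x * y)) <= (len (sref i * x * y)).+1.
      by apply: leq_trans (len_mul _ _) _; rewrite len_sref.
    by rewrite !mulgA sref_sref mul1g lxy l1.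
  rewrite (IHr _ _ h uJ l2 e lr') /star_sref !mulgA sref_sref mul1g l2 lxy ifT //; lia.
rewrite mulgA h -mulgA in e lr'.
rewrite (IHr _ _ xJ _ lxy e lr'); last by rewrite groupM ?sref_parabolic.
rewrite /star_sref ifF // mulgA h -mulgA lxy; apply/negbTE; rewrite -leqNgt.
by apply: leq_trans (len_mul _ _) _; rewrite leq_add2l ltnW // -ldesc_len; exact: dy.
Qed.

(** * Composition of core cosets in terms of minimal elements *)

Section Composition.
Variables p q : dcoset n.
Hypotheses (cp : core p) (cq : core q) (pq : rgt p = lft q).

Lemma len_comp_longest :
  len (minel p * minel q * longest (rgt q)) = len (minel p * minel q) + len (longest (rgt q)).
Proof.
have [bp c] := coreP cp; have [bq c'] := coreP cq; rewrite -pq in bq.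
by apply: (@rising_len _ (rgt q)) (longest_in _) => j; apply: blk_desc (blk_mul bp bq).
Qed.

Lemma reduced_star :
  len (minel p * minel q) = len (minel p) + len (minel q) ->
  star (maxel p) (maxel q) = minel p * minel q * longest (rgt q).
Proof.
move=> lpq; have [bp c] := coreP cp; have [bq c'] := coreP cq.
have l1 : len (minel q * longest (rgt q)) = len (minel q) + len (longest (rgt q)).
  by apply: (@rising_len _ (rgt q)) (longest_in _) => j; apply: blk_desc bq.
rewrite !maxel_core // -mulgA; apply: (@star_rising (rgt p)).
- by move=> j; apply: blk_desc bp.
- exact: longest_in.
(* Moving s_j across [minel q] turns it into some s_k with k in [rgt q], which shortens
   [longest (rgt q)]. *)
- move=> j; rewrite pq => jq; rewrite ldesc_len.
  have [k kq e] : exists2 k, k \in rgt q & sref j * minel q = minel q * sref k.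
    have := sref_parabolic jq; have [k kq e] := blk_conj (blk_inv bq c') jq.
    exists k => //; rewrite -[LHS]mul1g -(mulgV (minel q)) -!mulgA; congr (_ * _).
    by rewrite !mulgA e mulgKV.
  rewrite mulgA e -mulgA l1; apply: leq_ltn_trans (len_mul _ _) _.
  by rewrite ltn_add2l -ldesc_len longestV longest_desc.
by rewrite mulgA len_comp_longest lpq l1; exact: esym (addnA _ _ _).
Qed.

(** The longest element of the middle set cancels in the product of maximal elements, and the
    remaining longest elements contribute equally to both sides of the length condition. *)
Lemma reducedE : reduced p q = (len (minel p * minel q) == len (minel p) + len (minel q)).
Proof.
have [bp c] := coreP cp; have [bq c'] := coreP cq.
have l1 : len (minel q * longest (rgt q)) = len (minel q) + len (longest (rgt q)).
  by apply: (@rising_len _ (rgt q)) (longest_in _) => j; apply: blk_desc bq.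
have l2 : len (minel p * longest (rgt p)) = len (minel p) + len (longest (rgt p)).
  by apply: (@rising_len _ (rgt p)) (longest_in _) => j; apply: blk_desc bp.
have e : maxel p * (longest (rgt p))^-1 * maxel q = minel p * minel q * longest (rgt q).
  by rewrite !maxel_core // mulgK mulgA.
rewrite /reduced e; apply/and3P/eqP => [[_ /eqP -> /eqP]|lpq].
  by rewrite (maxel_core cp) (maxel_core cq) len_comp_longest l1 l2; lia.
rewrite (reduced_star lpq) eqxx pq eqxx; split=> [||]; [exact: isT | exact: isT |].
by rewrite (maxel_core cp) (maxel_core cq) len_comp_longest -pq l1 l2 lpq; lia.
Qed.

Lemma reduced_comp : reduced p q ->
  minel (dcomp p q) = minel p * minel q /\ core (dcomp p q).
Proof.
rewrite reducedE => /eqP lpq; have [bp c] := coreP cp; have [bq c'] := coreP cq.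
apply: blk_core => /=; last by rewrite [LHS]c pq.
  apply/(eltsP _ (elts_mk _ _ _)); exists 1, (longest (rgt q)).
  by rewrite group1 longest_in mul1g reduced_star // -[RHS]mulgA longestK mulg1.
by rewrite pq in bp; exact: blk_mul bp bq.
Qed.

End Composition.

End Cosets.

(** * Squashing *)

Section Squash.
Variables n k : nat.
Implicit Types (w x y u : W n) (z : W k) (a b : X n) (c d e : X k) (i j s t : 'I_n).
Implicit Types (I J K M : {set 'I_n}).

Definition cl J a : X k := inord (clv J a).

Section Labels.
Variable J : {set 'I_n}.
Hypothesis kJ : k = n - #|J|.

Lemma cl_val a : cl J a = clv J a :> nat.
Proof.
rewrite inordK // ltnS kJ -clv_all; apply: clv_mono.
by have := ltn_ord a; lia.
Qed.

Lemma cl_eq a b : (cl J a == cl J b) = (clv J a == clv J b).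
Proof. by rewrite ord_eqE !cl_val. Qed.

Lemma cl_rev a : cl J (rev_ord a) = rev_ord (cl J a).
Proof.
apply: ord_inj; rewrite val_rev !cl_val val_rev kJ -clv_all.
by rewrite -(@clv_rev _ J a) ?addnK //; have := ltn_ord a; lia.
Qed.

Lemma cl_surj c : exists a, cl J a = c.
Proof.
(* The least point whose label reaches c has label exactly c, since labels grow by at most one per
   step. *)
have ex : exists v, (c <= clv J v) && (v <= n.*2).
  by exists n.*2; rewrite leqnn clv_all -kJ; have := ltn_ord c; lia.
case: (ex_minnP ex) => v /andP[cv vn] min; have lt : v < n.*2.+1 by [].
exists (Ordinal lt); apply: ord_inj; rewrite cl_val /=; apply/eqP.
rewrite eqn_leq cv andbT; case: v cv vn min {lt} => [|v] cv vn min.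
  by rewrite /clv big_nil.
rewrite clvS leqNgt; apply/negP => h; suff : v < v by rewrite ltnn.
by apply: min; lia.
Qed.

Lemma sq_step_clv a b : sq_step J a b -> clv J a = clv J b.
Proof.
case/existsP => j /andP[jJ] /orP[] /andP[/eqP -> /eqP ->]; have ltj := ltn_ord j.
  rewrite !inordK; try lia.
  have -> : absz (n%:Z + (j%:Z + 1))%R = (n + j).+1 by lia.
  have -> : absz (n%:Z + j%:Z)%R = n + j by lia.
  by rewrite clvS ingap_pos jJ addn0.
rewrite !inordK; try lia.
have -> : absz (n%:Z - j%:Z)%R = (absz (n%:Z + (- j%:Z - 1))%R).+1 by lia.
by rewrite clvS (@ingap_neg _ J j) ?jJ ?addn0 //; lia.
Qed.

Lemma gap_sq_step a b : b = a.+1 :> nat -> ingap J a -> sq_step J a b || sq_step J b a.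
Proof.
move=> ab /existsP[j /andP[jJ h]]; have ltj := ltn_ord j; apply/orP.
case/orP: h => /eqP h; [left | right]; apply/existsP; exists j; rewrite jJ /=; apply/orP;
  [left | right]; apply/andP; split; apply/eqP/ord_inj; rewrite inordK; lia.
Qed.

Lemma sq_equivE a b : sq_equiv J a b = (clv J a == clv J b).
Proof.
apply/idP/eqP => [/connectP[p]|].
  elim: p a => [|c p IHp] a /=; first by move=> _ ->.
  by case/andP => /orP[/sq_step_clv ->|/sq_step_clv <-]; exact: IHp.
have step (c d : X n) : d = c.+1 :> nat -> ingap J c -> sq_equiv J c d && sq_equiv J d c.
  by move=> cd gc; apply/andP; split; apply/connect1 => /=; [|rewrite orbC]; exact: gap_sq_step.
have lt (c d : X n) : c < d -> clv J c = clv J d -> sq_equiv J c d && sq_equiv J d c.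
  move=> cd ecd; apply: (@class_rel n J (fun c d : X n => sq_equiv J c d && sq_equiv J d c) c d _ _ cd ecd) => //.
  move=> e f g /andP[h1 h2] /andP[h3 h4].
  by rewrite /sq_equiv (connect_trans h1 h3) (connect_trans h4 h2).
case: (ltngtP a b) => [ab|ba|/ord_inj -> _]; last exact: connect0.
  by move=> e; have /andP[] := lt _ _ ab e.
by move=> e; have /andP[] := lt _ _ ba (esym e).
Qed.

Lemma sq_classesE : sq_classes J = [set [set a | cl J a == c] | c : X k].
Proof.
have fib a : [set b in [set: X n] | sq_equiv J a b] = [set b | cl J b == cl J a].
  by apply/setP => b; rewrite !inE sq_equivE cl_eq eq_sym.
apply/setP => A; apply/imsetP/imsetP => [[a _ ->]|[c _ ->]].
  by exists (cl J a); rewrite ?fib.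
by have [a <-] := cl_surj c; exists a; rewrite ?fib.
Qed.

Lemma fib_inj : injective (fun c => [set a | cl J a == c]).
Proof.
move=> c d /setP e; have [a ac] := cl_surj c.
by have := e a; rewrite !inE ac eqxx => /esym/eqP.
Qed.

Lemma cl_lt a b : cl J a < cl J b -> a < b.
Proof. by rewrite !cl_val; apply: contraTT; rewrite -!leqNgt; exact: clv_mono. Qed.

Lemma cl_le a b : a <= b -> cl J a <= cl J b.
Proof. by rewrite !cl_val; exact: clv_mono. Qed.

Lemma class_lt_fib c d :
  class_lt [set a | cl J a == c] [set a | cl J a == d] = (c < d).
Proof.
apply/forallP/idP => [h|cd a].
  have [a ac] := cl_surj c; have [b bd] := cl_surj d.
  have := h a; rewrite inE ac eqxx => /forallP/(_ b); rewrite inE bd eqxx /=.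
  move=> ab; rewrite ltn_neqAle -ac -bd cl_le ?(ltnW ab) // andbT.
  apply/negP => /eqP/ord_inj; rewrite ac bd => e.
  have := h b; rewrite inE bd -e eqxx => /forallP/(_ a); rewrite inE ac eqxx /=; lia.
rewrite inE; apply/implyP => /eqP ac; apply/forallP => b; rewrite inE; apply/implyP => /eqP bd.
by apply: cl_lt; rewrite ac bd.
Qed.

(** The classes before the fibre of d are the fibres of the smaller labels, so there are d of
    them. *)
Lemma sq_classE c : sq_class J c = [set a | cl J a == c].
Proof.
have cnt d : #|[set B in sq_classes J | class_lt B [set a | cl J a == d]]| = d :> nat.
  have -> : [set B in sq_classes J | class_lt B [set a | cl J a == d]]
            = [set [set a | cl J a == e] | e in [set e : X k | e < d]].
    apply/setP => B; rewrite inE sq_classesE; apply/andP/imsetP.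
      by case=> /imsetP[e _ ->]; rewrite class_lt_fib => lt; exists e; rewrite ?inE.
    by case=> e; rewrite inE => lt ->; rewrite class_lt_fib lt imset_f.
  rewrite card_imset; last exact: fib_inj.
  rewrite -sum1_card big_set /= (eq_bigl (fun e : X k => e < d)) //.
  rewrite -(big_ord_widen _ (fun _ => 1%N)) ?sum1_card ?card_ord //.
  exact: ltnW.
apply/setP => a; apply/bigcupP/idP => [[A]|ac].
  case/andP; rewrite {1}sq_classesE => /imsetP[d _ ->]; rewrite cnt => /eqP/ord_inj ->.
  by [].
exists [set a | cl J a == c] => //; by rewrite {1}sq_classesE imset_f //= cnt.
Qed.

End Labels.

Section Induced.
Variables I J : {set 'I_n}.
Hypotheses (kI : k = n - #|I|) (kJ : k = n - #|J|).

Lemma inducesP x z : blk I J x ->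
  reflect (forall a, cl I (x a) = z (cl J a)) (induces I J x z).
Proof.
move=> bx; apply: (iffP forallP) => [h a|h c].
  have /andP[/eqP e _] := h (cl J a).
  have : x a \in x @: sq_class J (cl J a) by rewrite imset_f // sq_classE // inE.
  by rewrite e sq_classE // inE => /eqP.
apply/andP; split.
  apply/eqP/setP => b; rewrite !sq_classE // inE; apply/imsetP/eqP => [[a]|bc].
    by rewrite inE => /eqP <- ->; exact: h.
  exists (x^-1 b); last by rewrite wVK.
  by rewrite inE -(inj_eq (@wperm_inj _ z)) -h wVK bc.
apply/forallP => a; apply/implyP; rewrite sq_classE // inE => /eqP ac.
apply/forallP => b; apply/implyP; rewrite inE => /eqP bc.
apply/implyP => ab; apply: (rising_lt (J := J) (f := fun a => x a)) ab _.
  by apply/risingP => j; exact: blk_desc bx.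
by apply/eqP; rewrite -cl_eq // ac bc.
Qed.

Lemma card_class_sets : #|I| = #|J|.
Proof. have le (A : {set 'I_n}) : #|A| <= n by rewrite -[n in _ <= n]card_ord max_card.
by have := le I; have := le J; lia. Qed.

Lemma induced_ex x : blk I J x -> exists z, forall a, cl I (x a) = z (cl J a).
Proof.
move=> bx; have bxV := blk_inv bx card_class_sets.
(* The default is never taken, by [cl_surj]. The choice of the point does not affect the class of
   its image, by [blk_clv]. *)
pose rep c := odflt ord0 [pick a | cl J a == c].
have repE c : cl J (rep c) = c.
  rewrite /rep; case: pickP => [a /eqP //|]; have [a ac] := cl_surj kJ c.
  by move/(_ a); rewrite ac eqxx.
pose f c := cl I (x (rep c)).
have fE a : cl I (x a) = f (cl J a).
  apply/eqP; rewrite cl_eq //; apply/eqP/(blk_clv bx)/eqP.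
  by rewrite -cl_eq // repE.
have f_inj : injective f.
  move=> c d /eqP; rewrite cl_eq // => /eqP/(blk_clv bxV); rewrite !wK => /eqP.
  by rewrite -cl_eq // !repE => /eqP.
have sf : is_signed (perm f_inj).
  apply/forallP => c; rewrite !permE; have [a <-] := cl_surj kJ c.
  by rewrite -cl_rev // -!fE wrev cl_rev.
by exists (SignedPerm sf) => a; rewrite fE /= permE.
Qed.

Lemma Sqw_spec x : blk I J x -> forall a, cl I (x a) = Sqw k I J x (cl J a).
Proof.
move=> bx; rewrite /Sqw; case: pickP => [z /(inducesP _ bx) //|h].
by have [z /(inducesP _ bx)] := induced_ex bx; rewrite h.
Qed.

Lemma Sqw_uniq x z : blk I J x -> (forall a, cl I (x a) = z (cl J a)) -> Sqw k I J x = z.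
Proof.
move=> bx h; apply: wperm_ext => c; have [a <-] := cl_surj kJ c.
by rewrite -Sqw_spec.
Qed.

End Induced.

Lemma Sqw1 J : k = n - #|J| -> Sqw k J J 1 = 1.
Proof. by move=> kJ; apply: Sqw_uniq => //; [exact: blk1 | move=> a; rewrite !wone_id]. Qed.

Section Product.
Variables I J K : {set 'I_n}.
Hypotheses (kI : k = n - #|I|) (kJ : k = n - #|J|) (kK : k = n - #|K|).
Variables x y : W n.
Hypotheses (bx : blk I J x) (yb : blk J K y).

Lemma Sqw_mul : Sqw k I K (x * y) = Sqw k I J x * Sqw k J K y.
Proof.
apply: Sqw_uniq => //; first exact: blk_mul yb.
by move=> a; rewrite !wmulE (Sqw_spec kI kJ bx) (Sqw_spec kJ kK yb).
Qed.

Lemma Sqw_len : (len (x * y) == len x + len y) =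
  (len (Sqw k I J x * Sqw k J K y) == len (Sqw k I J x) + len (Sqw k J K y)).
Proof.
have Ex := Sqw_spec kI kJ bx; have Ey := Sqw_spec kJ kK yb.
apply/len_mulP/len_mulP => h.
  move=> c d; have [a <-] := cl_surj kK c; have [b <-] := cl_surj kK d.
  move=> /(cl_lt kK) ab; rewrite -!Ey => lt; have yab := cl_lt kJ lt; rewrite -!Ex.
  (* Comparing points gives only a weak inequality of labels; equality is excluded by injectivity of
     the squashed permutation. *)
  rewrite ltn_neqAle (cl_le kI) ?(ltnW (h _ _ ab yab)) // andbT.
  apply/negP => /eqP/ord_inj; rewrite !Ex => /wperm_inj e.
  by rewrite e ltnn in lt.
(* A block permutation inverts no pair inside a class, so this inversion is visible after
   squashing. *)
move=> a b ab yab; have ne : cl K a != cl K b.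
  apply/negP; rewrite cl_eq // => /eqP e.
  have /risingP up : forall j, j \in K -> ~~ desc y j by move=> j; exact: blk_desc yb.
  by have := rising_lt up ab e; lia.
have lt c d : c <= d -> c != d -> c < d by move=> ?; rewrite ltn_neqAle -ord_eqE => ->.
apply: (cl_lt kI); rewrite !Ex !Ey; apply: h.
  by apply: lt ne; apply: cl_le => //; exact: ltnW.
apply: lt; first by rewrite -!Ey; apply: cl_le => //; exact: ltnW.
by rewrite (inj_eq (@wperm_inj _ _)) eq_sym.
Qed.

End Product.

(** Here y x^-1 is a block permutation relative to I' and I that induces the identity. Inside
    classes it rises as a block permutation, across classes because labels are kept. Once x = y,
    both left sets are given by x J x^-1. *)
Lemma Sqw_inj I I' J x y : k = n - #|I| -> k = n - #|I'| -> k = n - #|J| ->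
  blk I J x -> blk I' J y -> Sqw k I J x = Sqw k I' J y -> I = I' /\ x = y.
Proof.
move=> kI kI' kJ bx yb e.
have cIJ := card_class_sets kI kJ; have cI'J := card_class_sets kI' kJ.
have h a : cl I' (y a) = cl I (x a) by rewrite (Sqw_spec kI kJ bx) e -(Sqw_spec kI' kJ yb).
have xy : x = y.
  suff t1 : y * x^-1 = 1 by rewrite -[x]mul1g -t1 mulgKV.
  apply: no_desc => i; have [iI|iI] := boolP (i \in I).
    exact: blk_desc (blk_mul yb (blk_inv bx cIJ)) iI.
  rewrite ndesc; apply: (cl_lt kI'); rewrite !wmulE !h !wVK !(cl_val kI) lo_val hi_val.
  by rewrite clvS ingap_pos iI addn1.
split=> //; apply: (imset_inj (@sref_inj n)).
by rewrite (blk_set bx cIJ) (blk_set yb cI'J) xy.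
Qed.

(* Adding t to J closes two gaps, between t and t + 1 and between -t - 1 and -t. *)
Lemma clv_setU1 J t v : t \notin J ->
  clv J v = clv (t |: J) v + (n - t.+1 < v) + (n + t < v).
Proof.
move=> tJ; have ltt := ltn_ord t; elim: v => [|v IHv]; first by rewrite /clv !big_nil; lia.
rewrite !clvS IHv; have : ingap (t |: J) v = [|| v == n + t, v == n - t.+1 | ingap J v].
  apply/existsP/idP => [[j /andP[]]|].
    rewrite !inE => /orP[/eqP -> h|jJ h].
      by apply/orP; case/orP: h => /eqP h; [left | right; apply/orP; left]; lia.
    by apply/or3P; constructor 3; apply/existsP; exists j; rewrite jJ.
  case/or3P => [/eqP h|/eqP h|/existsP[j /andP[jJ h]]].
  - by exists t; rewrite !inE eqxx h eqxx.
  - by exists t; rewrite !inE eqxx; apply/orP; right; lia.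
  by exists j; rewrite !inE jJ orbT.
have [->|n1] := eqVneq v (n + t); first by rewrite (ingap_pos J t) (negbTE tJ) => ->; lia.
have [e|n2] := eqVneq v (n - t.+1).
  by rewrite (@ingap_neg _ J t) ?(negbTE tJ); last lia; move=> ->; lia.
by move=> ->; case: ingap; lia.
Qed.

Lemma clv0 v : clv (set0 : {set 'I_n}) v = v.
Proof.
elim: v => [|v IHv]; first by rewrite /clv big_nil.
rewrite clvS IHv; suff /negbTE -> : ~~ ingap (set0 : {set 'I_n}) v by rewrite addn1.
by apply/existsP => [[j]]; rewrite inE.
Qed.

End Squash.

(** * Merging classes: atomic cosets squash to simple reflections *)

Section Merge.
Variables n k : nat.
Implicit Types (w x y u : W n) (z : W k) (a b : X n) (i j s t : 'I_n).
Implicit Types (I J K M : {set 'I_n}) (c e f : 'I_k).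

(** Squashing in two stages: the gap t lies over the gap c of Y_k, so adding t to J amounts to
    squashing by J and then closing c together with its mirror. *)
Lemma clv_cut J t c a : k = n - #|J| -> t \notin J -> clv J (n + t) = k + c ->
  clv [set c] (clv J a) = clv (t |: J) a.
Proof.
move=> kJ tJ ct; have ltt := ltn_ord t; have lta := ltn_ord a; have ltc := ltn_ord c.
have ct1 : clv J (n + t).+1 = (k + c).+1 by rewrite clvS ingap_pos tJ ct addn1.
have kk : clv J n.*2 = k.*2 by rewrite clv_all kJ.
have mt : clv J (n - t) = k - c.
  by have := @clv_rev n J (n + t); have -> : n.*2 - (n + t) = n - t; lia.
have mt1 : clv J (n - t.+1) = k - c.+1.
  by have := @clv_rev n J (n + t).+1; have -> : n.*2 - (n + t).+1 = n - t.+1; lia.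
have e1 : (k - c.+1 < clv J a) = (n - t.+1 < a).
  have [h|h] := ltnP (n - t.+1) a; last by have := clv_mono J h; lia.
  by have := @clv_mono n J (n - t) a; lia.
have e2 : (k + c < clv J a) = (n + t < a).
  have [h|h] := ltnP (n + t) a; last by have := clv_mono J h; lia.
  by have := @clv_mono n J (n + t).+1 a; lia.
have := clv_setU1 a tJ; have := @clv_setU1 k set0 c (clv J a).
rewrite inE clv0 setU0 e1 e2 => /(_ isT); lia.
Qed.

(** A permutation preserving the classes of {c} can only have the descent c. Both z and z s_c are of
    this kind; z falls at c, so z s_c has no descent left. *)
Lemma cut_sref c z : (forall d, clv [set c] (z d) = clv [set c] d) -> z != 1 -> z = sref c.
Proof.
have only (y : W k) e : (forall d, clv [set c] (y d) = clv [set c] d) -> desc y e -> e = c.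
  move=> py; rewrite /desc => lt; apply/eqP; have := clv_mono [set c] (ltnW lt).
  by rewrite !py hi_val lo_val clvS ingap_pos inE; case: eqP => //= _; lia.
move=> pz /exists_desc[e dz]; have ec := only z e pz dz; rewrite {}ec in dz.
have y1 : z * sref c = 1.
  apply: no_desc => f; apply/negP => df; have fc : f = c.
    by apply: only df => d; rewrite wmulE pz clv_sref // inE.
  by move: df dz; rewrite fc !desc_len -mulgA sref_sref mulg1; lia.
by rewrite -[RHS]mul1g -y1 -mulgA sref_sref mulg1.
Qed.

Lemma cut_index J t : k = n - #|J| -> t \notin J -> exists c, clv J (n + t) = k + c.
Proof.
move=> kJ tJ; have ltt := ltn_ord t.
have h1 : k <= clv J (n + t) by rewrite kJ -clv_mid clv_mono // leq_addr.
have h2 : (clv J (n + t)).+1 <= k.*2.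
  have : clv J (n + t).+1 <= clv J n.*2 by apply: clv_mono; lia.
  by rewrite clv_all -kJ clvS ingap_pos tJ addn1.
have lt : clv J (n + t) - k < k by lia.
by exists (Ordinal lt) => /=; lia.
Qed.

Lemma index_cut J c : k = n - #|J| -> exists2 t, t \notin J & clv J (n + t) = k + c.
Proof.
move=> kJ; have ltc := ltn_ord c; have kk : clv J n.*2 = k.*2 by rewrite clv_all kJ.
have ex : exists v, (v <= n.*2) && (clv J v <= k + c) by exists 0; rewrite /clv big_nil.
have ub v : (v <= n.*2) && (clv J v <= k + c) -> v <= n.*2 by case/andP.
(* The last point with label at most k + c: the gap just above it separates two classes, hence is
   not in J, and it is nonnegative because 0 has label k. *)
case: (ex_maxnP ex ub) => v /andP[vn cv] max.
have nv : n <= v by apply: max; rewrite clv_mid -kJ; lia.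
have lt : v < n.*2 by rewrite ltn_neqAle vn andbT; apply: contraTneq cv => ->; lia.
have c1 : k + c < clv J v.+1.
  by rewrite ltnNge; apply/negP => h; have := max v.+1; rewrite h lt ltnn => /(_ isT).
have ltt : v - n < n by lia.
have := ingap_pos J (Ordinal ltt); rewrite /= subnKC // => g.
exists (Ordinal ltt); rewrite /= ?subnKC // -?g; move: c1; rewrite clvS; case: ingap => //=; lia.
Qed.

Lemma longest_conj M t : t \in M ->
  exists2 s, s \in M & longest M * sref t = sref s * longest M.
Proof.
move=> tM; have [||e g] := @longest_gap n M (lo t) (hi t); rewrite ?lo_val ?hi_val ?ingap_pos //.
have [|s gs] := @gap_index n (longest M (hi t)); first by have := ltn_ord (longest M (lo t)); lia.
exists s; first by rewrite -(ingap_index M gs).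
by apply: conj_sref (adj_lohi t) _; rewrite /adj e eqxx gs orbT.
Qed.

Section Atomic.
Variables (M : {set 'I_n}) (s t : 'I_n).
Hypotheses (sM : s \in M) (tM : t \in M).
Hypothesis st : longest M * sref t = sref s * longest M.
Let I := M :\ s.
Let J := M :\ t.
Let x := longest M * longest J.

(** w_J and w_M each reverse a J-gap, so their product shifts it to a gap of M. That gap is not s,
    since w_M conjugates s to t only, and t is not in J. *)
Lemma atomic_blk : blk I J x.
Proof.
move=> a b ab gJ; have [e1 g1] := longest_gap ab gJ.
have sub v : ingap J v -> ingap M v.
  case/existsP => j /andP[/setD1P[_ jM] h]; apply/existsP; exists j; by rewrite jM.
have [e2 g2] := longest_gap e1 (sub _ g1); rewrite !wmulE; split=> //.
have [|j gj] := @gap_index n (longest J b); first by have := ltn_ord (longest J a); lia.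
have jJ : j \in J by rewrite -(ingap_index J gj).
have [|i gi] := @gap_index n (longest M (longest J a)).
  by have := ltn_ord (longest M (longest J b)); lia.
rewrite (ingap_index _ gi) !inE -(ingap_index M gi) g2 andbT; apply/negP => /eqP ei.
suff : j = t by move=> jt; move: jJ; rewrite jt !inE eqxx.
have adj1 : adj j (longest J b) (longest J a) by rewrite /adj e1 eqxx gj.
have := @conj_sref n (longest M) i j _ _ adj1; rewrite /adj e2 eqxx gi orbT => /(_ isT).
by rewrite ei -st => /mulgI/sref_inj.
Qed.

Lemma atomic_card : #|I| = #|J|.
Proof.
by have := cardsD1 s M; rewrite sM (cardsD1 t M) tM => /eqP; rewrite eqn_add2l => /eqP.
Qed.

(** w_M sends the gap of t, inside its M-class, to the gap of s or its mirror. This places s and t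
    over the same gap of Y_k. *)
Lemma atomic_clv : clv M (n + s) = clv M (n + t).
Proof.
have [||e g] := @longest_gap n M (lo t) (hi t); rewrite ?lo_val ?hi_val ?ingap_pos //.
have ct : clv M (longest M (hi t)) = clv M (n + t).
  by rewrite clv_parabolic ?longest_in // hi_val clvS ingap_pos tM addn0.
have [|i gi] := @gap_index n (longest M (hi t)); first by have := ltn_ord (longest M (lo t)); lia.
have ei : i = s.
  have := @conj_sref n (longest M) i t _ _ (adj_lohi t).
  by rewrite /adj e eqxx gi orbT => /(_ isT); rewrite st => /mulIg/sref_inj.
rewrite ei in gi; case/ingap1_eq: gi => h; first by rewrite -h.
(* Mirror case: the two labels are opposite and neither is below that of 0, so both equal it. *)
have le1 : clv M n <= clv M (n + t) by apply: clv_mono; lia.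
have le2 : clv M n <= clv M (n + s) by apply: clv_mono; lia.
have := @clv_rev n M (longest M (hi t)); rewrite ct clv_all -clv_mid.
have -> : n.*2 - longest M (hi t) = (n + s).+1 by lia.
by rewrite clvS ingap_pos sM addn0 => /(_ _); lia.
Qed.

Lemma atomic_parabolic : x \in parabolic M.
Proof.
rewrite groupM ?longest_in //; apply: subsetP (longest_in J).
by apply: genS; apply: imsetS; exact: subD1set.
Qed.

Lemma Sqw_atomic c : k = n - #|J| -> clv J (n + t) = k + c -> Sqw k I J x = sref c.
Proof.
move=> kJ ct; have kI : k = n - #|I| by rewrite atomic_card.
have tJ : t \notin J by rewrite !inE eqxx.
have sI : s \notin I by rewrite !inE eqxx.
have MJ : t |: J = M by rewrite setD1K.
have MI : s |: I = M by rewrite setD1K.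
have cs : clv I (n + s) = k + c.
  have := clv_setU1 (n + s) sI; have := clv_setU1 (n + t) tJ.
  have := ltn_ord s; have := ltn_ord t; rewrite MI MJ atomic_clv ct; lia.
set z := Sqw k I J x; have Ez := Sqw_spec kI kJ atomic_blk.
have pz d : clv [set c] (z d) = clv [set c] d.
  have [a <-] := cl_surj kJ d; rewrite -Ez !cl_val // (clv_cut _ kI sI cs) (clv_cut _ kJ tJ ct).
  by rewrite MI MJ clv_parabolic // atomic_parabolic.
(* w_J keeps [lo t] and [hi t] in their distinct J-classes, and x sends the resulting points to
   w_M(lo t) > w_M(hi t); so the order of these two classes is not kept. *)
have z1 : z != 1.
  apply/eqP => z1.
  have [||e1 g1] := @longest_gap n M (lo t) (hi t); rewrite ?lo_val ?hi_val ?ingap_pos //.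
  have := Ez (longest J (lo t)); have := Ez (longest J (hi t)); rewrite -/z z1 !wone_id.
  move=> /(congr1 (@nat_of_ord _)) h1 /(congr1 (@nat_of_ord _)) h2.
  have : cl k I (x (longest J (hi t))) <= cl k I (x (longest J (lo t))).
    apply: cl_le => //; rewrite -!wmulE /x -mulgA longestK mulg1.
    by rewrite e1.
  rewrite h1 h2 !cl_val // !clv_parabolic ?longest_in // lo_val hi_val clvS ingap_pos.
  by rewrite (negbTE tJ); lia.
exact: cut_sref.
Qed.

End Atomic.
End Merge.

(** * Core and atomic cosets *)

Section CoreCosets.
Variables n k : nat.
Implicit Types (w x y u : W n) (z : W k) (i j s t : 'I_n).
Implicit Types (I J K M : {set 'I_n}) (p q r : dcoset n) (c : 'I_k).

Lemma core_card p : core p -> k = n - #|rgt p| -> k = n - #|lft p|.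
Proof. by case/coreP => _ ->. Qed.

Lemma core_Sq_inj p q : core p -> core q -> rgt p = rgt q -> k = n - #|rgt p| ->
  Sq k p = Sq k q -> p = q.
Proof.
move=> cp cq pq kp e; have kp' := core_card cp kp; rewrite pq in kp.
have kq' := core_card cq kp.
have [bp _] := coreP cp; have [bq _] := coreP cq; rewrite /Sq pq in bp e.
have [el em] := Sqw_inj kp' kq' kp bp bq e.
by rewrite (mk_dcosetE (minel_in p)) (mk_dcosetE (minel_in q)) el em pq.
Qed.

Lemma core_id J : k = n - #|J| ->
  core (mk_dcoset J J 1) /\ Sq k (mk_dcoset J J 1) = 1.
Proof.
move=> kJ; have [||//|e c] := @blk_core n (mk_dcoset J J 1) 1; first exact: elts_mk.
  exact: blk1.
by split=> //; rewrite /Sq e; exact: Sqw1.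
Qed.

Lemma comp_Sq p q : core p -> core q -> rgt p = lft q -> k = n - #|rgt q| ->
  reduced p q = (len (Sq k p * Sq k q) == len (Sq k p) + len (Sq k q)).
Proof.
move=> cp cq pq kq; rewrite (reducedE cp cq pq).
have [bp _] := coreP cp; have [bq _] := coreP cq; have kq' := core_card cq kq.
have kp : k = n - #|rgt p| by rewrite pq.
have kp' := core_card cp kp; rewrite /Sq -pq in bq *.
exact: Sqw_len.
Qed.

Lemma comp_core p q : core p -> core q -> k = n - #|rgt q| -> reduced p q ->
  core (dcomp p q) /\ Sq k (dcomp p q) = Sq k p * Sq k q.
Proof.
move=> cp cq kq rpq; have pq : rgt p = lft q by case/and3P: rpq => /eqP.
have [e c] := reduced_comp cp cq pq rpq; split=> //.
have [bp _] := coreP cp; have [bq _] := coreP cq; have kq' := core_card cq kq.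
have kp : k = n - #|rgt p| by rewrite pq.
have kp' := core_card cp kp; rewrite /Sq e -pq in bq *.
exact: Sqw_mul.
Qed.

Lemma mk_atomic M s t c : s \in M -> t \in M -> longest M * sref t = sref s * longest M ->
  k = n - #|M :\ t| -> clv (M :\ t) (n + t) = k + c ->
  core (mk_dcoset (M :\ s) (M :\ t) (longest M)) /\
  Sq k (mk_dcoset (M :\ s) (M :\ t) (longest M)) = sref c.
Proof.
move=> sM tM st kJ ct; set p := mk_dcoset _ _ _.
have xp : longest M * longest (M :\ t) \in elts p.
  apply/(eltsP _ (elts_mk _ _ _)); exists 1, (longest (M :\ t)).
  by rewrite group1 longest_in mul1g.
have [e cp] := blk_core xp (atomic_blk sM tM st) (atomic_card sM tM).
by split=> //; rewrite /Sq e; exact: Sqw_atomic ct.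
Qed.

Lemma atomic_core p : atomic p -> k = n - #|rgt p| -> core p /\ exists c, Sq k p = sref c.
Proof.
case/existsP => M /existsP[s /andP[sM]] /existsP[t /andP[/eqP st /eqP ->]] kJ.
have {}st : longest M * sref t = sref s * longest M by rewrite st !mulgA longestK mul1g.
(* Conjugation by w_M permutes the simple reflections of M, so t, the conjugate of s, is in M. *)
have tM : t \in M.
  have [t' t'M e] := longest_conj sM.
  rewrite (_ : t = t') //; apply: sref_inj; apply: (mulgI (longest M)).
  by rewrite st -[LHS]mul1g -(longestK M) -!mulgA (mulgA _ (sref s)) e -mulgA longestK mulg1.
have tJ : t \notin M :\ t by rewrite !inE eqxx.
have [c ct] := cut_index kJ tJ.
by have [cp e] := mk_atomic sM tM st kJ ct; split=> //; exists c.
Qed.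

Lemma atomic_ex J c : k = n - #|J| ->
  exists p, [/\ atomic p, rgt p = J & Sq k p = sref c].
Proof.
move=> kJ; have [t tJ ct] := index_cut c kJ; pose M := t |: J.
have tM : t \in M by rewrite setU11.
have [s sM st] := longest_conj tM; have MJ : M :\ t = J by rewrite setU1K.
exists (mk_dcoset (M :\ s) (M :\ t) (longest M)); split; last 2 first.
- by [].
- by rewrite -MJ in kJ ct; have [] := mk_atomic sM tM st kJ ct.
apply/existsP; exists M; apply/existsP; exists s; rewrite sM /=; apply/existsP; exists t.
have e : longest M * sref s = sref t * longest M.
  rewrite -[RHS]mul1g -(longestK M) -!mulgA; congr (_ * _).
  by rewrite mulgA st -mulgA longestK mulg1.
by rewrite eqxx andbT e -mulgA longestK mulg1.
Qed.

(** Letters are added on the left, where the new right set is known. The coset is made directly from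
    the product of minimal elements, since block permutations compose whether or not lengths add. *)
Lemma core_ex J z : k = n - #|J| -> exists p, [/\ core p, rgt p = J & Sq k p = z].
Proof.
move=> kJ; have [v <- _] := len_word z; elim: v => [|c v [p [cp pJ e]]].
  by exists (mk_dcoset J J 1); have [] := core_id kJ; rewrite /wprod big_nil.
have kp : k = n - #|rgt p| by rewrite pJ.
have kp' := core_card cp kp; have [q [aq qp eq]] := atomic_ex c kp'.
have kq : k = n - #|rgt q| by rewrite qp.
have [cq _] := atomic_core aq kq; have kq' := core_card cq kq.
have [bp cardp] := coreP cp; have [bq cardq] := coreP cq.
have [|||e' c'] := @blk_core n (mk_dcoset (lft q) (rgt p) (minel q * minel p)) (minel q * minel p).
- exact: elts_mk.
- by rewrite qp in bq; exact: blk_mul bq bp.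
- by rewrite [LHS]cardq qp.
exists (mk_dcoset (lft q) (rgt p) (minel q * minel p)); split=> //.
rewrite wprod_cons -e -eq /Sq e' qp in bq *.
by rewrite (Sqw_mul kq' kp' kp bq bp).
Qed.

End CoreCosets.

(** * Atomic reduced expressions *)

Lemma atomic_is_core n (p : dcoset n) : atomic p -> core p.
Proof. by move=> ap; have [] := @atomic_core n (n - #|rgt p|) p ap erefl. Qed.

(** The total length is the largest that subadditivity allows, so every intermediate bound is
    attained. *)
Lemma len_prefix k (x y z : W k) m : len y = 1%N -> len z <= m ->
  len (x * y * z) = len x + m.+1 -> len (x * y) = len x + len y.
Proof. by have := len_mul x y; have := len_mul (x * y) z; lia. Qed.

Lemma srefs_prod_len k (v : seq (W k)) :
  all (mem (srefs k)) v -> len (\prod_(t <- v) t) <= size v.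
Proof.
elim: v => [|t v IHv] /=; first by rewrite big_nil len1.
case/andP => /imsetP[c _ ->] /IHv le; rewrite big_cons.
by apply: leq_trans (len_mul _ _) _; rewrite len_sref.
Qed.

(* sq is a variable because failing to unify Sq k p with Sq k q, for p and q
   different, takes very long: both get unfolded. *)
Section Sequences.
Variables (n k : nat) (sq : dcoset n -> W k).
Hypothesis sqE : sq = @Sq n k.
Implicit Types (z : W k) (J : {set 'I_n}) (p q r : dcoset n) (qs : seq (dcoset n)).

Definition joins : rel (dcoset n) := fun p q => rgt p == lft q.

Lemma joins_rank q r : atomic r -> rgt q = lft r -> k = n - #|rgt q| -> k = n - #|rgt r|.
Proof. by move=> /atomic_is_core/coreP[_ <-] <-. Qed.

Lemma sq_atomic p : atomic p -> k = n - #|rgt p| -> sq p \in srefs k.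
Proof. by move=> ap kp; rewrite sqE; have [_ [c ->]] := atomic_core ap kp; rewrite imset_f. Qed.

Lemma sq_len1 p : atomic p -> k = n - #|rgt p| -> len (sq p) = 1%N.
Proof. by move=> ap kp; have /imsetP[c _ ->] := sq_atomic ap kp; exact: len_sref. Qed.

Lemma sq_reduced p q : core p -> core q -> rgt p = lft q -> k = n - #|rgt q| ->
  reduced p q = (len (sq p * sq q) == len (sq p) + len (sq q)).
Proof. by rewrite sqE; exact: comp_Sq. Qed.

Lemma sq_comp p q : core p -> core q -> k = n - #|rgt q| -> reduced p q ->
  core (dcomp p q) /\ sq (dcomp p q) = sq p * sq q.
Proof. by rewrite sqE; exact: comp_core. Qed.

Lemma sq_inj p q : core p -> core q -> rgt p = rgt q -> k = n - #|rgt p| ->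
  sq p = sq q -> p = q.
Proof. by rewrite sqE; exact: core_Sq_inj. Qed.

Lemma sq_id J : k = n - #|J| -> sq (mk_dcoset J J 1) = 1.
Proof. by rewrite sqE => /core_id[]. Qed.

Lemma sq_atomic_ex J z : k = n - #|J| -> z \in srefs k ->
  exists p, [/\ atomic p, rgt p = J & sq p = z].
Proof. by rewrite sqE => kJ /imsetP[c _ ->]; exact: atomic_ex. Qed.

Lemma path_srefs q qs : k = n - #|rgt q| -> all (@atomic n) qs -> path joins q qs ->
  all (mem (srefs k)) (map sq qs).
Proof.
elim: qs q => //= r qs IHqs q kq /andP[ar aqs] /andP[/eqP qr pqs].
have kr := joins_rank ar qr kq.
by apply/andP; split; [exact: sq_atomic | exact: IHqs kr aqs pqs].
Qed.

Lemma path_reduced q qs : core q -> k = n - #|rgt q| -> all (@atomic n) qs ->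
  path joins q qs ->
  len (sq q * \prod_(t <- map sq qs) t) = len (sq q) + size qs ->
  reduced_seq q qs.
Proof.
elim: qs q => [//|r qs IHqs] q cq kq /= /andP[ar aqs] /andP[/eqP qr pqs].
have cr := atomic_is_core ar; have kr := joins_rank ar qr kq.
have l1 := sq_len1 ar kr; rewrite big_cons mulgA => l.
have le1 := srefs_prod_len (path_srefs kr aqs pqs); rewrite size_map in le1.
have l2 := len_prefix l1 le1 l.
have rqr : reduced q r by rewrite (sq_reduced cq cr qr kr); apply/eqP.
have [cqr eqr] := sq_comp cq cr kr rqr.
apply/andP; split; first exact: rqr.
apply: (IHqs _ cqr kr aqs); first by case: (qs) pqs.
by rewrite eqr; apply: (etrans l); rewrite l2; lia.
Qed.

Lemma reduced_path q qs : core q -> k = n - #|rgt q| -> all (@atomic n) qs ->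
  reduced_seq q qs ->
  [/\ path joins q qs,
      core (foldl (@dcomp n) q qs),
      lft (foldl (@dcomp n) q qs) = lft q /\ rgt (foldl (@dcomp n) q qs) = rgt (last q qs),
      sq (foldl (@dcomp n) q qs) = sq q * \prod_(t <- map sq qs) t &
      len (sq (foldl (@dcomp n) q qs)) = len (sq q) + size qs].
Proof.
elim: qs q => [|r qs IHqs] q cq kq.
  by move=> _ _; rewrite big_nil mulg1 addn0.
case/andP => ar aqs /andP[rqr rqs]; have qr : rgt q = lft r by case/and3P: rqr => /eqP.
have cr := atomic_is_core ar; have kr := joins_rank ar qr kq.
have [cqr eqr] := sq_comp cq cr kr rqr.
have [h1 h2 [h3 h4] h5 h6] := IHqs (dcomp q r) cqr kr aqs rqs.
have lqr := sq_reduced cq cr qr kr; rewrite rqr in lqr; move/esym/eqP: lqr => lqr.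
have lr := sq_len1 ar kr.
split.
- by apply/andP; split; [exact/eqP | case: (qs) h1].
- exact: h2.
- by split; [exact: h3 | apply: (etrans h4); case: (qs)].
- by apply: (etrans h5); rewrite eqr big_cons mulgA.
have e2 : len (sq q * sq r) = (len (sq q)).+1.
  by apply: (etrans lqr); apply: (etrans (congr1 (addn _) lr)); exact: addn1.
by apply: (etrans h6); rewrite eqr e2; exact: esym (addnS _ _).
Qed.

(** The right set J determines the last coset from its squash; its left set is the right set of the
    coset before it, and so on. The conclusion on k passes the rank to the next coset on the
    left. *)
Lemma path_inj J q qs q' qs' : k = n - #|J| ->
  all (@core n) (q :: qs) -> all (@core n) (q' :: qs') ->
  path joins q qs -> path joins q' qs' -> rgt (last q qs) = J -> rgt (last q' qs') = J ->
  map sq (q :: qs) = map sq (q' :: qs') ->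
  q :: qs = q' :: qs' /\ k = n - #|lft q|.
Proof.
move=> kJ; elim: qs q q' qs' => [|r qs IHqs] q q' [|r' qs'].
- move=> /andP[cq _] /andP[cq' _] _ _ qJ q'J [e].
  have kq : k = n - #|rgt q| by rewrite qJ.
  have -> : q = q' by apply: sq_inj cq cq' _ kq e; rewrite qJ.
  by split=> //; rewrite (coreP cq').2 q'J.
- by move=> _ _ _ _ _ _ [].
- by move=> _ _ _ _ _ _ [].
move=> /andP[cq cqs] /andP[cq' cqs'] /andP[/eqP qr p1] /andP[/eqP qr' p2] e1 e2 [e e3 e4].
have [|[er es] kr] := IHqs r r' qs' cqs cqs' p1 p2 e1 e2; first by congr (_ :: _).
have kq : k = n - #|rgt q| by rewrite qr.
have -> : q = q' by apply: sq_inj cq cq' _ kq e; rewrite qr qr' er.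
by rewrite er es; split=> //; rewrite (coreP cq').2 qr' -er.
Qed.

Lemma lift_path J (v : seq (W k)) t : k = n - #|J| -> all (mem (srefs k)) (t :: v) ->
  exists q qs, [/\ all (@atomic n) (q :: qs), path joins q qs, rgt (last q qs) = J,
    map sq (q :: qs) = t :: v & k = n - #|rgt q|].
Proof.
move=> kJ; elim: v t => [|t' v IHv] t.
  case/andP => st _; have [p [ap pJ e]] := sq_atomic_ex kJ st.
  by exists p, [::]; rewrite /= ap e pJ.
case/andP => st /IHv[q [qs [aq pq lq evs kq]]].
have cq := atomic_is_core (andP aq).1.
have kq' : k = n - #|lft q| by rewrite (coreP cq).2.
have [p [ap pJ e]] := sq_atomic_ex kq' st.
exists p, (q :: qs); split; [| |exact: lq| |by rewrite pJ].
- by apply/andP.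
- by apply/andP; split=> //; exact/eqP.
by rewrite -evs -e.
Qed.

Lemma atomic_rex_cons p q qs : core p -> atomic_rex p (q :: qs) ->
  [/\ #|rgt q| = #|rgt p|, all (@atomic n) (q :: qs), reduced_seq q qs &
      p = foldl (@dcomp n) q qs].
Proof.
move=> cp /andP[aqqs /andP[rqs /eqP e]]; split=> //.
have cq := atomic_is_core (andP aqqs).1; rewrite -(coreP cq).2 -(coreP cp).2 e.
by elim: (qs) (q) => //= r s IHs t; rewrite -IHs.
Qed.

Lemma atomic_rex_bij p : core p -> k = n - #|rgt p| ->
  bij_on (atomic_rex p) (rex (sq p)) (map sq).
Proof.
move=> cp kp; have crex q qs : atomic_rex p (q :: qs) ->
    [/\ k = n - #|rgt q|, all (@atomic n) (q :: qs), reduced_seq q qs & p = foldl (@dcomp n) q qs].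
  by case/(atomic_rex_cons cp) => ->.
split=> [[|q qs]|ps ps'|v].
(* The empty expression is only allowed for an identity coset, whose squash is 1, of length 0. *)
- move=> /eqP e; have lp : lft p = rgt p by rewrite [in RHS]e.
  have sp : sq p = 1 by rewrite e lp; exact: sq_id.
  by rewrite sp /rex big_nil len1 !eqxx.
- case/crex => kq /andP[aq aqs] rqs e; have cq := atomic_is_core aq.
  have [pq _ _ e1 e2] := reduced_path cq kq aqs rqs; rewrite -e in e1 e2.
  apply/and3P; split.
  + by apply/andP; split; [exact: sq_atomic | exact: path_srefs kq aqs pq].
  + by rewrite e1 big_cons.
  by rewrite e2 (sq_len1 aq kq) size_map.
- have cores q qs : all (@atomic n) (q :: qs) -> all (@core n) (q :: qs).
    by apply: sub_all => r; exact: atomic_is_core.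
  case: ps ps' => [|q qs] [|q' qs']; [by []| by move=> _ _ []| by move=> _ _ []|].
  move=> /crex[kq a1 r1 e1] /crex[kq' a2 r2 e2] e.
  have [aq aqs] := andP a1; have [aq' aqs'] := andP a2.
  have [p1 _ [_ l1] _ _] := reduced_path (atomic_is_core aq) kq aqs r1.
  have [p2 _ [_ l2] _ _] := reduced_path (atomic_is_core aq') kq' aqs' r2.
  rewrite -e1 in l1; rewrite -e2 in l2.
  by have [] := path_inj kp (cores _ _ a1) (cores _ _ a2) p1 p2 (esym l1) (esym l2) e.
case: v => [|t v] /and3P[av /eqP pv /eqP lv].
  exists [::] => //; apply/eqP.
  have pe : p = mk_dcoset (rgt p) (rgt p) 1.
    apply: (sq_inj cp _ _ kp); [exact: (core_id kp).1 | by [] |].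
    by rewrite sq_id // -pv big_nil.
  by rewrite [in LHS]pe; congr (mk_dcoset _ _ _); rewrite pe.
have [q [qs [aqqs pq lq e kq]]] := lift_path kp av; exists (q :: qs) => //.
have [aq aqs] := andP aqqs; have cq := atomic_is_core aq.
have prod : sq p = sq q * \prod_(u <- map sq qs) u by rewrite -pv -e big_cons.
have rqs : reduced_seq q qs.
  by apply: (path_reduced cq kq aqs pq); rewrite -prod -lv -e (sq_len1 aq kq) size_map.
have [_ cf [_ lf] ef _] := reduced_path cq kq aqs rqs.
apply/andP; split=> //; apply/andP; split=> //; apply/eqP.
(* The composition of the lifted sequence has the same right set and the same squash as p, hence
   equals p. *)
by apply: (sq_inj cp cf _ kp); rewrite ?lf ?lq // ef.
Qed.

End Sequences.

Theorem theorem4p7 (n m k : nat) (J : {set 'I_n})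
    (card_J : #|J| = m) (def_k : k = (n - m)%N) :
  [/\ forall p p' p'' : dcoset n,
        #|lft p'| = m -> #|rgt p'| = m -> #|rgt p''| = m ->
        core p' -> core p'' ->
        p = dcomp p' p'' -> reduced p' p'' ->
        Sq k p = Sq k p' * Sq k p'' /\
        len (Sq k p' * Sq k p'') = (len (Sq k p') + len (Sq k p''))%N,
      [/\ bij_on (core_pairs J) predT (@SqJ n k),
          forall x, atomic_pairs J x -> core_pairs J x &
          bij_on (atomic_pairs J) [in srefs k] (@SqJ n k)] &
      forall p : dcoset n, core p -> rgt p = J ->
        bij_on (atomic_rex p) (rex (Sq k p)) (map (@Sq n k))].
Proof.
have kJ : k = n - #|J| by rewrite card_J.
have a2c x : atomic_pairs J x -> core_pairs J x.
  by case/and3P => l r /atomic_is_core c; apply/and3P.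
have SqJ_inj x y : core_pairs J x -> core_pairs J y -> SqJ k x = SqJ k y -> x = y.
  case: x y => [I p] [I' q] /and3P[/eqP/= <- /eqP pJ cp] /and3P[/eqP/= <- /eqP qJ cq] e.
  by rewrite (core_Sq_inj cp cq _ _ e) ?pJ ?qJ.
split; last 1 first.
- by move=> p cp pJ; apply: (atomic_rex_bij erefl cp); rewrite pJ.
- move=> p p' p'' _ _ rp'' cp' cp'' -> red.
  have kp : k = n - #|rgt p''| by rewrite rp''.
  have pq : rgt p' = lft p'' by case/and3P: red => /eqP.
  split; first exact: (comp_core cp' cp'' kp red).2.
  by apply/eqP; rewrite -(comp_Sq cp' cp'' pq kp).
split; [split | exact: a2c | split].
- by [].
- exact: SqJ_inj.
- move=> z _; have [p [cp pJ e]] := core_ex z kJ; exists (lft p, p); last exact: e.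
  by apply/and3P; split; [exact/eqP | exact/eqP | exact: cp].
- by move=> x /and3P[_ /eqP xJ ax]; apply: (sq_atomic erefl ax); rewrite xJ.
- by move=> x y /a2c cx /a2c cy; exact: SqJ_inj.
move=> z /imsetP[c _ ->]; have [p [ap pJ e]] := atomic_ex c kJ.
by exists (lft p, p); [apply/and3P; split; [exact/eqP | exact/eqP | exact: ap] | exact: e].
Qed.
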